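(* Let $K$ be a non-Archimedean local field, $n\ge1$, $\alpha>0$. Let $F\in\Phi'(K,\Phi'(K^n))$ be a generalized solution of the equation $D_t^\alpha F-D_x^{\alpha,n}F=0$, that is, $$\left\langle\left\langle F,D_t^\alpha\varphi_1\right\rangle,\varphi_2\right\rangle=\left\langle\left\langle F,\varphi_1\right\rangle,D_x^{\alpha,n}\varphi_2\right\rangle$$ for any $\varphi_1\in\Phi(K)$, $\varphi_2\in\Phi(K^n)$. If $F$ is radial in $t$, then $F\in\mathcal D(K,\Phi'(K^n))$. If, in addition, $F(0,x)=0$ or $\left(D_t^{n-1}F\right)(0,x)=0$, then $F(t,x)\equiv0$.
   Context: A non-Archimedean local field $K$ is a non-discrete totally disconnected locally compact topological field; $|\cdot|$ is its normalized absolute value, $q$ is the cardinality of the residue field. Haar measure $dx$ on $K$ gives $\{|x|\le1\}$ measure $1$; $d^nx=dx_1\cdots dx_n$; $\|x\|=\max_j|x_j|$ on $K^n$. A function $f$ on $K^m$ is locally constant if there is an integer $l$ with $f(x+x')=f(x)$ for all $x$ and all $\|x'\|\le q^{-l}$. $\mathcal D(K^m)$ is the space of complex-valued compactly supported locally constant functions on $K^m$, with its usual topology as an inductive limit of the finite-dimensional subspaces of functions with support in a fixed ball and a fixed exponent $l$ of local constancy. Lizorkin space: $\Phi(K^m)=\{\varphi\in\mathcal D(K^m):\int_{K^m}\varphi\,d^mx=0\}$; $\Phi'(K^m)$ is its (strong) dual. $\Phi'(K,\Phi'(K^n))$ is the set of distributions over the test function space $\Phi(K)$ with values in $\Phi'(K^n)$,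 i.e. (continuous) linear maps $\varphi_1\mapsto\langle F,\varphi_1\rangle$ from $\Phi(K)$ to $\Phi'(K^n)$. The variable of $K$ is denoted $t$ and that of $K^n$ is denoted $x$; a distribution in $t$ is also written as if it were a function of $t$. Operators: let $\chi$ be a fixed unitary additive character of $K$ of rank zero ($\chi=1$ on $\{|x|\le1\}$, $\chi(x_0)\neq1$ for some $|x_0|=q$), $(\mathcal F\varphi)(\xi)=\int\chi(x\cdot\xi)\varphi(x)\,dx$ the Fourier transform. For $\alpha>0$, $D^\alpha\varphi=\mathcal F^{-1}[|\xi|^\alpha\mathcal F\varphi]$ for $\varphi\in\mathcal D(K)$ and $D^{\alpha,n}\varphi=\mathcal F^{-1}[\|\xi\|^\alpha\mathcal F\varphi]$ for $\varphi\in\mathcal D(K^n)$; these operators map $\Phi(K)$ to $\Phi(K)$ and $\Phi(K^n)$ to $\Phi(K^n)$ respectively. For $v\in\mathcal D(K)$ one has pointwise $(D^\alpha v)(t)=\frac{1-q^\alpha}{1-q^{-\alpha-1}}\int_K|y|^{-\alpha-1}[v(t-y)-v(t)]\,dy$. $D^{n-1}$ is $D^\alpha$ with $\alpha=n-1$ for $n\ge2$; $D^0$ is the identity. Radial in $t$: $\langle F,\varphi_\omega\rangle=\langle F,\varphi\rangle$ for all $\varphi\in\Phi(K)$ and all $\omega\in K$ with $|\omega|=1$, where $\varphi_\omega(t)=\varphi(\omega t)$. $F\in\mathcal D(K,\Phi'(K^n))$ means: $F$ is given by a function $t\mapsto F(t,\cdot)\in\Phi'(K^n)$ such that for every $\varphi_2\in\Phi(K^n)$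 the function $t\mapsto\langle F(t,\cdot),\varphi_2\rangle$ belongs to $\mathcal D(K)$, and $\langle\langle F,\varphi_1\rangle,\varphi_2\rangle=\int_K\langle F(t,\cdot),\varphi_2\rangle\varphi_1(t)\,dt$ for all $\varphi_1\in\Phi(K)$. The condition $F(0,x)=0$ means $\langle F(0,\cdot),\varphi_2\rangle=0$ for all $\varphi_2\in\Phi(K^n)$; the condition $(D_t^{n-1}F)(0,x)=0$ means that for all $\varphi_2\in\Phi(K^n)$ the function $D^{n-1}$ applied to $t\mapsto\langle F(t,\cdot),\varphi_2\rangle$ vanishes at $t=0$. *)

(* Defs.v *)
From HB Require Import structures.
From mathcomp Require Import all_boot all_order all_algebra.
From mathcomp Require Import complex.
From mathcomp Require Import all_classical all_reals all_analysis.

Set Implicit Arguments.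
Unset Strict Implicit.
Unset Printing Implicit Defensive.

Import Order.TTheory GRing.Theory Num.Theory.
Import numFieldTopology.Exports.

Local Open Scope classical_set_scope.
Local Open Scope ring_scope.
Local Open Scope complex_scope.

HB.mixin Record TopologicalZmodule_isTopologicalField K
    & GRing.Field K & TopologicalZmodule K := {
  fmul_continuous : continuous (fun x : K * K => x.1 * x.2) ;
  finv_continuous : forall x : K, x != 0 -> {for x, continuous (@GRing.inv K)}
}.

#[short(type="topologicalFieldType")]
HB.structure Definition TopologicalField :=
  {K of GRing.Field K & TopologicalZmodule K
        & TopologicalZmodule_isTopologicalField K}.

HB.mixin Record TopologicalField_isNonArchLocalField K & TopologicalField K := {
  nonarch_nondiscrete : ~ (forall A : set K, open A) ;
  nonarch_totally_disconnected : totally_disconnected [set: K] ;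
  nonarch_locally_compact : locally_compact [set: K]
}.

#[short(type="nonArchLocalFieldType")]
HB.structure Definition NonArchLocalField :=
  {K of TopologicalField K & TopologicalField_isNonArchLocalField K}.

(* The residue field is {|x| <= 1} / {|x| < 1}; [r] is a complete system of
   representatives. *)
Definition residue_cardinality (R : realType) (K : fieldType)
    (abs : K -> R) (q : nat) : Prop :=
  exists r : 'I_q -> K,
    [/\ forall i, abs (r i) <= 1,
        forall i j, abs (r i - r j) < 1 -> i = j
      & forall x, abs x <= 1 -> exists i, abs (x - r i) < 1].

Record normalized_absval (R : realType) (K : nonArchLocalFieldType)
    (abs : K -> R) (q : nat) : Prop := NormalizedAbsval {
  absval_ge0 : forall x, 0 <= abs x ;
  absval_eq0 : forall x, abs x = 0 <-> x = 0 ;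
  absvalM : forall x y, abs (x * y) = abs x * abs y ;
  absvalD : forall x y, abs (x + y) <= Num.max (abs x) (abs y) ;
  absval_topology : forall A : set K, nbhs (0 : K) A <->
    exists2 eps : R, 0 < eps & [set x | abs x < eps] `<=` A ;
  absval_residue : residue_cardinality abs q ;
  (* the value group is exactly q^Z *)
  absval_values : forall x, x != 0 -> exists k : int, abs x = q%:R ^ k ;
  absval_uniformizer : exists p : K, abs p = q%:R^-1
}.

(* K with its Borel sigma-algebra; the library asks for a distinguished point
   in order to generate a sigma-algebra, and 0 is taken. *)
Definition pointed_carrier (K : nonArchLocalFieldType) : Type := K.
HB.instance Definition _ (K : nonArchLocalFieldType) :=
  Choice.on (pointed_carrier K).
HB.instance Definition _ (K : nonArchLocalFieldType) :=
  isPointed.Build (pointed_carrier K) (0 : K).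
Notation borel K :=
  (g_sigma_algebraType (@open K : set (set (pointed_carrier K)))).

(* Regularity is automatic, since a local field is second countable. *)
Record normalized_haar (R : realType) (K : nonArchLocalFieldType)
    (abs : K -> R) (mu : {measure set (borel K) -> \bar R}) : Prop :=
  NormalizedHaar {
  haar_invariant : forall (a : K) (A : set (borel K)), measurable A ->
    mu [set a + x | x in A] = mu A ;
  haar_compact : forall A : set K, compact A -> (mu A < +oo)%E ;
  haar_unit : mu [set x | abs x <= 1] = 1%E
}.

Record rank_zero_character (R : realType) (K : nonArchLocalFieldType)
    (abs : K -> R) (q : nat) (chi : K -> R[i]) : Prop := RankZeroCharacter {
  charD : forall x y, chi (x + y) = chi x * chi y ;
  char_unitary : forall x, `|chi x| = 1 ;
  char_continuous : continuous (chi : K -> (R[i] : numFieldType)) ;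
  char_trivial : forall x, abs x <= 1 -> chi x = 1 ;
  char_rank : exists x0, abs x0 = q%:R /\ chi x0 != 1
}.

(* The absolute value, the residue cardinality and the Haar measure are
   determined by K; the character is a choice, fixed once and for all. *)
Record local_field_data (R : realType) (K : nonArchLocalFieldType) :=
  LocalFieldData {
  absv : K -> R ;
  resq : nat ;
  haar : {measure set (borel K) -> \bar R} ;
  chi : K -> R[i] ;
  absvP : normalized_absval absv resq ;
  haarP : normalized_haar absv haar ;
  chiP : rank_zero_character absv resq chi
}.

HB.saturate matrix.

Section Integrals.
Context (R : realType) (K : nonArchLocalFieldType) (S : local_field_data R K).
Implicit Types (n : nat).

Definition integral1 (f : K -> R[i]) : R[i] :=
  Rintegral (haar S) setT (fun x : borel K => complex.Re (f x))
  +i* Rintegral (haar S) setT (fun x : borel K => complex.Im (f x)).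

(* Iterated integral dx_1 ... dx_n; [row_mx x%:M y] is (x, y_1, ..., y_m). *)
Fixpoint integraln n : ('rV[K]_n -> R[i]) -> R[i] :=
  match n return ('rV[K]_n -> R[i]) -> R[i] with
  | 0 => fun f => f 0
  | m.+1 => fun f => integral1 (fun x : K =>
      integraln (fun y : 'rV[K]_m => f (row_mx (x%:M : 'rV[K]_1) y)))
  end.

Definition normn n (x : 'rV[K]_n) : R := \big[Num.max/0]_(j < n) absv S (x 0 j).

Definition dotn n (x y : 'rV[K]_n) : K := \sum_(j < n) x 0 j * y 0 j.

End Integrals.

(* Common packaging of K and of K^n, so that the function spaces and operators
   below are defined once for both. *)
Record kspace (R : realType) (K : nonArchLocalFieldType) := KSpace {
  kcarrier :> PreTopologicalZmodule.type ;
  knorm : kcarrier -> R ;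
  kdot : kcarrier -> kcarrier -> K ;
  kint : (kcarrier -> R[i]) -> R[i]
}.

Definition line (R : realType) (K : nonArchLocalFieldType)
    (S : local_field_data R K) : kspace R K :=
  @KSpace R K K (absv S) *%R (integral1 S).

Definition affine (R : realType) (K : nonArchLocalFieldType)
    (S : local_field_data R K) (n : nat) : kspace R K :=
  @KSpace R K 'rV[K]_n (@normn R K S n) (@dotn K n) (@integraln R K S n).

Section FunctionSpaces.
Context (R : realType) (K : nonArchLocalFieldType) (S : local_field_data R K).
Variable V : kspace R K.
Local Notation C := R[i].
Local Notation q := ((resq S)%:R : R).
Implicit Types (f g phi psi : V -> C) (l N : int).

Definition lin (a : C) f (b : C) g : V -> C := fun x => a * f x + b * g x.

Definition constancy_exponent l f : Prop :=
  forall x x' : V, knorm x' <= q ^ (- l) -> f (x + x') = f x.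

Definition locally_constant f : Prop := exists l, constancy_exponent l f.

Definition compactly_supported f : Prop :=
  exists2 A : set V, compact A & forall x, ~ A x -> f x = 0.

(* D(V) *)
Definition test : set (V -> C) :=
  [set f | compactly_supported f /\ locally_constant f].

(* Phi(V) *)
Definition lizorkin : set (V -> C) := [set f | test f /\ kint f = 0].

(* The finite-dimensional subspace of functions with support in the ball of
   radius q^N and exponent of local constancy l. *)
Definition test_step N l : set (V -> C) :=
  [set f | (forall x, q ^ N < knorm x -> f x = 0) /\ constancy_exponent l f].

Definition absolutely_convex (W : set (V -> C)) : Prop :=
  forall (a b : C) f g, `|a| + `|b| <= 1 -> W f -> W g -> W (lin a f b g).

(* Neighbourhoods of 0 for the locally convex inductive limit topology: the
   sets containing an absolutely convex set whose trace on every step is a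
   neighbourhood of 0. The sup norm gives the topology of a
   finite-dimensional step. *)
Definition test_nbhs0 (U : set (V -> C)) : Prop :=
  exists W : set (V -> C),
    [/\ absolutely_convex W,
        forall N l, exists2 eps : R, 0 < eps &
          forall f, test_step N l f -> (forall x, `|f x| < eps%:C) -> W f,
        W `<=` test
      & W `<=` U].

(* Phi(V) carries the topology induced by D(V). *)
Definition lizorkin_nbhs0 (U : set (V -> C)) : Prop :=
  exists2 W, test_nbhs0 W & W `&` lizorkin `<=` U.

Definition lizorkin_bounded (B : set (V -> C)) : Prop :=
  B `<=` lizorkin /\
  forall U, lizorkin_nbhs0 U ->
    exists2 r : R, 0 < r & forall f, B f -> U (fun x => r^-1%:C * f x).

(* Phi'(V). Functionals are total functions of which only the values on
   Phi(V) matter. Continuity of a linear map is continuity at 0. *)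
Definition lizorkin_dual (T : (V -> C) -> C) : Prop :=
  (forall (a b : C) f g, lizorkin f -> lizorkin g ->
     T (lin a f b g) = a * T f + b * T g) /\
  (forall eps : R, 0 < eps -> lizorkin_nbhs0 [set f | `|T f| < eps%:C]).

Definition fourier f : V -> C :=
  fun xi => kint (fun x : V => chi S (kdot x xi) * f x).

(* With the Haar measure and the character normalized as above, this is the
   inverse of [fourier] on D(V). *)
Definition inverse_fourier f : V -> C :=
  fun x => kint (fun xi : V => chi S (- kdot x xi) * f xi).

Definition fracD (alpha : R) f : V -> C :=
  inverse_fourier (fun xi => (knorm xi `^ alpha)%:C * fourier f xi).

(* D^k for a natural number k, with D^0 the identity. *)
Definition fracDn (k : nat) f : V -> C :=
  if k is 0 then f else fracD k%:R f.

End FunctionSpaces.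

Section Equation.
Context (R : realType) (K : nonArchLocalFieldType) (S : local_field_data R K).
Variable n : nat.
Local Notation C := R[i].
Implicit Type F : (K -> C) -> ('rV[K]_n -> C) -> C.

(* Phi'(K, Phi'(K^n)); Phi'(K^n) has the strong topology, of uniform
   convergence on the bounded subsets of Phi(K^n). *)
Definition vdistribution F : Prop :=
  [/\ forall phi1, lizorkin S (V := line S) phi1 ->
        lizorkin_dual S (V := affine S n) (F phi1),
      forall (a b : C) phi1 psi1 phi2,
        lizorkin S (V := line S) phi1 -> lizorkin S (V := line S) psi1 ->
        lizorkin S (V := affine S n) phi2 ->
        F (lin (V := line S) a phi1 b psi1) phi2 =
          a * F phi1 phi2 + b * F psi1 phi2
    & forall B (eps : R), lizorkin_bounded S (V := affine S n) B -> 0 < eps ->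
        lizorkin_nbhs0 S (V := line S)
          [set phi1 | forall phi2, B phi2 -> `|F phi1 phi2| < eps%:C]].

Definition generalized_solution (alpha : R) F : Prop :=
  forall phi1 phi2,
    lizorkin S (V := line S) phi1 -> lizorkin S (V := affine S n) phi2 ->
    F (fracD S (V := line S) alpha phi1) phi2 =
    F phi1 (fracD S (V := affine S n) alpha phi2).

Definition radial F : Prop :=
  forall phi1 phi2 (omega : K),
    lizorkin S (V := line S) phi1 -> lizorkin S (V := affine S n) phi2 ->
    absv S omega = 1 ->
    F (fun t => phi1 (omega * t)) phi2 = F phi1 phi2.

(* F belongs to D(K, Phi'(K^n)) and is given by the function t |-> f t. *)
Definition given_by F (f : K -> ('rV[K]_n -> C) -> C) : Prop :=
  [/\ forall t, lizorkin_dual S (V := affine S n) (f t),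
      forall phi2, lizorkin S (V := affine S n) phi2 ->
        test S (V := line S) (fun t => f t phi2)
    & forall phi1 phi2,
        lizorkin S (V := line S) phi1 -> lizorkin S (V := affine S n) phi2 ->
        F phi1 phi2 = integral1 S (fun t => f t phi2 * phi1 t)].

End Equation.

(* Main.v *)
Require Import Defs.
From HB Require Import structures.
From mathcomp Require Import all_boot all_order all_algebra.
From mathcomp Require Import complex.
From mathcomp Require Import all_classical all_reals all_analysis.
From mathcomp Require Import ring lra zify.
Import Order.TTheory GRing.Theory Num.Theory.
Set Implicit Arguments.
Unset Strict Implicit.
Unset Printing Implicit Defensive.
Local Open Scope classical_set_scope.
Local Open Scope ring_scope.
Local Open Scope complex_scope.

(** The equation decouples under the Fourier transform. Write |xi| = q^k for a
    frequency sphere. A Lizorkin function is a finite sum of pieces whose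
    Fourier transforms live on single spheres, and both fractional operators
    multiply a piece of frequency q^k by q^(k alpha). Hence, if phi1 has
    frequency q^j and phi2 has frequency q^k, the equation reads
    q^(j alpha) F(phi1, phi2) = q^(k alpha) F(phi1, phi2), so F vanishes unless
    j = k (spectral_orthogonal).

    Radiality in t allows phi1 to be replaced by its mean over the units of K.
    A radial function of frequency q^k is a multiple of one explicit function
    e_k, the inverse Fourier transform of the indicator of the sphere of radius
    q^k (spectral_radial). The multiple is read off at t = 0, where the piece of
    frequency q^k of phi1 takes the value int e_k phi1. Therefore
      F(phi1, phi2) = sum_k (int e_k phi1) / e_k(0) * F(e_k, phi2)
    (F_expansion). By orthogonality only the finitely many frequencies of phi2
    contribute, so F is given by the function
      f(t, phi2) = sum_k e_k(t) / e_k(0) * F(e_k, phi2),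
    a finite sum of test functions of t (solution_density_given_by). Each f(t, .)
    is continuous because every linear functional on the Lizorkin space is
    (linear_lizorkin_dual).

    A function representing F is unique, because a compactly supported function
    orthogonal to all functions of integral 0 is constant, hence 0
    (given_by_unique). For phi2 of the single frequency q^k, f(t, phi2) is
    e_k(t) / e_k(0) * F(e_k, phi2). Its value at t = 0 is F(e_k, phi2), and
    D^(n-1) multiplies it by a positive constant. So either initial condition
    forces F(e_k, phi2) = 0 for all k, and then f = 0 (given_by_vanishing).

    All analysis takes place on step functions, that is, functions supported in
    a ball of radius q^N and invariant under translation by the ball of radius
    q^M. Their integrals are finite sums over representatives of the cosets of
    the small ball in the large one, so Fubini and Fourier inversion become
    rearrangements of finite sums. The line K and the space K^n enter only
    through the properties collected in the record selfdual. *)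

(** * The absolute value *)

Section AbsoluteValue.
Context (R : realType) (K : nonArchLocalFieldType) (S : local_field_data R K).
Local Notation ab := (absv S).
Implicit Types (x y : K).

Lemma abs0 : ab 0 = 0. Proof. exact/(absval_eq0 (absvP S)). Qed.

Lemma absM x y : ab (x * y) = ab x * ab y. Proof. exact: (absvalM (absvP S)). Qed.

Lemma abs_eq0 x : (ab x == 0) = (x == 0).
Proof. by apply/eqP/eqP => /(absval_eq0 (absvP S)). Qed.

Lemma abs1 : ab 1 = 1.
Proof.
have /eqP := absM 1 1; rewrite mulr1 -{1}[ab 1]mulr1 -subr_eq0 -mulrBr mulf_eq0.
by rewrite abs_eq0 oner_eq0 subr_eq0 => /eqP.
Qed.

Lemma absN x : ab (- x) = ab x.
Proof.
have a2 : ab (-1) * ab (-1) = 1 by rewrite -absM mulrNN mulr1 abs1.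
have : ab (-1) = 1 by move: a2 (absval_ge0 (absvP S) (-1)); nra.
by rewrite -[- x]mulN1r absM => ->; rewrite mul1r.
Qed.

Lemma absV x : ab x^-1 = (ab x)^-1.
Proof.
have [->|x0] := eqVneq x 0; first by rewrite invr0 abs0 invr0.
apply: (mulfI (x := ab x)); first by rewrite abs_eq0.
by rewrite -absM !mulfV ?abs1 ?abs_eq0.
Qed.

Lemma resq_gt1 : 1 < ((resq S)%:R : R).
Proof.
have [r [r1 r2 r3]] := absval_residue (absvP S).
rewrite ltr1n; case: (resq S) r r1 r2 r3 => [|[|//]] r r1 r2 r3.
  by have [] := r3 0; [rewrite abs0|case].
(* With a single residue class, 0 and 1 would be congruent. *)
have [|i Hi] := r3 1; first by rewrite abs1.
have [|j Hj] := r3 0; first by rewrite abs0.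
have ij : i = j by rewrite (ord1 i) (ord1 j).
move: Hj; rewrite sub0r -ij absN => Hj.
have := absvalD (absvP S) (1 - r i) (r i); rewrite subrK abs1 le_max !leNgt.
by rewrite Hi Hj.
Qed.

End AbsoluteValue.

(** * Balls, step functions and self-dual spaces *)

Section Balls.
Context (R : realType) (K : nonArchLocalFieldType) (S : local_field_data R K).
Variable V : kspace R K.
Local Notation C := R[i].
Local Notation q := ((resq S)%:R : R).
Implicit Types (f g : V -> C) (N M m k : int) (x y : V) (s : seq V).

(** Radii are powers of q, so balls are indexed by the exponent. *)
Definition inball k x : bool := knorm x <= q ^ k.

Definition periodic M f : Prop :=
  forall x x', inball M x' -> f (x + x') = f x.

Definition supported N f : Prop := forall x, ~~ inball N x -> f x = 0.

Definition step N M f : Prop := supported N f /\ periodic M f.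

(** A complete system of representatives of the ball of radius q^N modulo the
    ball of radius q^M. Counting congruent entries with multiplicity makes sums
    over such systems easy to compare. *)
Definition coset_reps N M s : Prop :=
  all (inball N) s /\
  forall x, inball N x -> count (fun r => inball M (x - r)) s = 1%N.

(** The measure of a ball of radius q^M in dimension d. *)
Definition vol (d : nat) M : C := ((q ^ M) ^+ d)%:C.

(** What the Fourier analysis uses of K and K^n. The two fields on chi say that
    the ball of radius q^(-k) is the annihilator of the ball of radius q^k for
    the pairing chi (x . y). *)
Record selfdual (d : nat) : Prop := Selfdual {
  ball0 : forall k, inball k 0 ;
  ballD : forall k x y, inball k x -> inball k y -> inball k (x + y) ;
  ballN : forall k x, inball k (- x) = inball k x ;
  ball_exhaust : forall x, exists k, inball k x ;
  ball_proper : forall k, exists x, ~~ inball k x ;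
  sphere_norm : forall k x, inball k x -> ~~ inball (k - 1) x ->
    knorm x = q ^ k ;
  dotDl : forall x y z : V, kdot (x + y) z = kdot x z + kdot y z ;
  dotC : forall x y : V, kdot x y = kdot y x ;
  chi_dot1 : forall k x y, inball k x -> inball (- k) y ->
    chi S (kdot x y) = 1 ;
  chi_dot_neq1 : forall k y, ~~ inball (- k) y ->
    exists2 b, inball k b & chi S (kdot b y) != 1 ;
  kint_reps : forall N M, M <= N -> exists2 s, coset_reps N M s &
    forall f, step N M f -> kint f = vol d M * \sum_(r <- s) f r ;
  testP : forall f, test S f <-> exists N M, step N M f
}.
End Balls.

(** * Sums over coset representatives *)

Section LinearCombinations.
Context (R : realType) (K : nonArchLocalFieldType) (S : local_field_data R K).
Variable V : kspace R K.
Local Notation C := R[i].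

(** The induction behind every exchange of a linear operation T with a finite
    sum: T is linear only on the functions satisfying P, so membership of the
    partial sums in P has to be carried along. *)
Lemma linear_comb (P : (V -> C) -> Prop) (T : (V -> C) -> C) :
  P (fun=> 0) -> (forall a f b g, P f -> P g -> P (lin a f b g)) ->
  (forall a f b g, P f -> P g -> T (lin a f b g) = a * T f + b * T g) ->
  forall (I : eqType) (s : seq I) (c : I -> C) (g : I -> V -> C),
    (forall i, i \in s -> P (g i)) ->
    P (fun x => \sum_(i <- s) c i * g i x) /\
    T (fun x => \sum_(i <- s) c i * g i x) = \sum_(i <- s) c i * T (g i).
Proof.
move=> P0 Plin Tlin I s c g; elim: s => [|a s IH] gP.
  have -> : (fun x => \sum_(i <- [::]) c i * g i x) = lin 0 (fun=> 0) 0 (fun=> 0).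
    by apply/funext => x; rewrite big_nil /lin !mul0r addr0.
  by rewrite Tlin// !mul0r addr0 big_nil; split=> //; apply: Plin.
have [|Ps Ts] := IH; first by move=> i si; apply: gP; rewrite inE si orbT.
have Pa : P (g a) by apply: gP; rewrite inE eqxx.
have -> : (fun x => \sum_(i <- a :: s) c i * g i x) =
    lin (c a) (g a) 1 (fun x => \sum_(i <- s) c i * g i x).
  by apply/funext => x; rewrite /lin big_cons mul1r.
by split; [apply: Plin|rewrite Tlin// Ts big_cons mul1r].
Qed.

End LinearCombinations.

Section Averages.
Context (R : realType) (K : nonArchLocalFieldType) (S : local_field_data R K).
Variables (V : kspace R K) (d : nat).
Hypothesis sdV : @selfdual R K S V d.
Local Notation C := R[i].
Local Notation q := ((resq S)%:R : R).
Implicit Types (f g : V -> C) (N M m k : int) (x y : V) (s : seq V).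
Local Notation inball := (@inball R K S V).
Local Notation periodic := (@periodic R K S V).
Local Notation supported := (@supported R K S V).
Local Notation step := (@step R K S V).
Local Notation coset_reps := (@coset_reps R K S V).
Local Notation vol := (@vol R K S d).
Local Notation chi := (chi S).

Let q_gt1 : 1 < q := resq_gt1 S.
Let q_gt0 : 0 < q. Proof. exact: lt_trans q_gt1. Qed.
Let q_neq0 : q != 0. Proof. exact: lt0r_neq0. Qed.

Lemma vol_neq0 M : vol M != 0.
Proof. by rewrite fmorph_eq0 expf_neq0// expfz_neq0. Qed.

Lemma volVN M : vol M * vol (- M) = 1.
Proof. by rewrite -rmorphM /= -exprMn -expfzDr// subrr expr0z expr1n. Qed.

Lemma ball_le k k' x : k <= k' -> inball k x -> inball k' x.
Proof. by move=> kk' /le_trans; apply; rewrite ler_eXz2l. Qed.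

Lemma ballB k x y : inball k x -> inball k y -> inball k (x - y).
Proof. by move=> xk yk; apply: (ballD sdV) => //; rewrite (ballN sdV). Qed.

Lemma ballDl k x y : inball k x -> inball k (x + y) = inball k y.
Proof.
move=> xk; apply/idP/idP => [|/(ballD sdV xk)//].
by move=> /ballB/(_ xk); rewrite addrC addKr.
Qed.

Lemma ballDr k x y : inball k y -> inball k (x + y) = inball k x.
Proof. by rewrite addrC; apply: ballDl. Qed.

Lemma step_le N N' M M' f : N <= N' -> M' <= M -> step N M f -> step N' M' f.
Proof.
move=> NN' MM' [f0 fM]; split=> [x xN|x x' /(ball_le MM')]; last exact: fM.
by apply: f0; apply: contra xN; apply: ball_le.
Qed.

Lemma periodic_le M M' f : M' <= M -> periodic M f -> periodic M' f.
Proof. by move=> MM' fM x x' /(ball_le MM'); apply: fM. Qed.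

Lemma step_testL f : (exists L : nat, step L (- L%:Z) f) <-> test S f.
Proof.
split=> [[L fL]|/(testP sdV)[N [M fNM]]]; first by apply/(testP sdV); exists L, (- L%:Z).
exists (absz N + absz M)%N; apply: step_le fNM; lia.
Qed.

Lemma kint_ext f g : f =1 g -> kint f = kint g.
Proof. by move=> fg; congr kint; apply/funext. Qed.

Lemma reps_refl m : coset_reps m m [:: 0].
Proof.
split=> [|x xm] /=; first by rewrite (ball0 sdV).
by rewrite subr0 xm.
Qed.

Lemma count_sum (P : V -> bool) s : (count P s)%:R = \sum_(r <- s) (P r)%:R :> C.
Proof.
by rewrite -sum1_count big_mkcond /= natr_sum; apply: eq_bigr => r _; case: (P r).
Qed.

(** Both sums equal the sum over pairs of congruent representatives, which
    avoids exhibiting the bijection between the two systems. *)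
Lemma reps_sum N M f s s' : periodic M f ->
  coset_reps N M s -> coset_reps N M s' ->
  \sum_(r <- s) f r = \sum_(r <- s') f r.
Proof.
move=> fM [sN s1] [s'N s'1].
have E x : inball N x -> \sum_(r <- s') (inball M (x - r))%:R = 1 :> C.
  by move=> xN; rewrite -count_sum s'1.
transitivity (\sum_(r <- s) \sum_(r' <- s') f r' * (inball M (r - r'))%:R).
  rewrite big_seq [RHS]big_seq; apply: eq_bigr => r /(allP sN) rN.
  rewrite -[LHS]mulr1 -[X in _ * X = _](E _ rN) mulr_sumr; apply: eq_bigr => r' _.
  have [rr'|_] := boolP (inball M (r - r')); rewrite /= ?mulr0 ?mulr1 //.
  by rewrite -(fM r' _ rr') addrC subrK.
rewrite exchange_big /= big_seq [RHS]big_seq; apply: eq_bigr => r' /(allP s'N) rN.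
have s1r : \sum_(r <- s) (inball M (r' - r))%:R = 1 :> C.
  by rewrite -count_sum s1.
rewrite -mulr_sumr -[RHS]mulr1 -[X in _ = _ * X]s1r.
by congr (_ * _); apply: eq_bigr => r _; rewrite -(ballN sdV) opprB.
Qed.

Lemma reps_ex N M : M <= N -> exists s, coset_reps N M s.
Proof. by move=> /(kint_reps sdV)[s sP _]; exists s. Qed.

Lemma kint_step N M f s : M <= N -> step N M f -> coset_reps N M s ->
  kint f = vol M * \sum_(r <- s) f r.
Proof.
move=> MN fNM sP; have [s' s'P ->//] := kint_reps sdV MN.
by congr (_ * _); apply: reps_sum fNM.2 s'P sP.
Qed.

Lemma reps_shift N M b s : inball N b -> coset_reps N M s ->
  coset_reps N M [seq b + r | r <- s].
Proof.
move=> bN [sN s1]; split=> [|x xN].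
  by rewrite all_map; apply/allP => r /(allP sN) /= rN; apply: (ballD sdV).
rewrite count_map -(s1 (x - b)) ?ballB//; apply: eq_count => r /=.
by rewrite opprD addrA.
Qed.

Lemma test_stepT N M f : step N M f -> test S f.
Proof. by move=> fNM; apply/(testP sdV); exists N, M. Qed.

Lemma test_lin a f b g : test S f -> test S g -> test S (lin a f b g).
Proof.
move=> /(testP sdV)[N [M [f0 fM]]] /(testP sdV)[N' [M' [g0 gM]]].
apply/(testP sdV); exists (Num.max N N'), (Num.min M M'); split => [x xN|x x' xM].
  by rewrite /lin f0 ?g0 ?mulr0 ?addr0//; apply: contra xN; apply: ball_le;
    rewrite le_max lexx ?orbT.
rewrite /lin fM ?gM//; apply: ball_le xM; by rewrite ge_min lexx ?orbT.
Qed.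

Lemma kint_lin a f b g : test S f -> test S g ->
  kint (lin a f b g) = a * kint f + b * kint g.
Proof.
move=> /step_testL[L fL] /step_testL[L' gL].
set n := (L + L')%N.
have {}fL : step n (- n%:Z) f by apply: step_le fL; rewrite /n; lia.
have {}gL : step n (- n%:Z) g by apply: step_le gL; rewrite /n; lia.
have nn : - n%:Z <= n%:Z by lia.
have [s sP] := reps_ex nn.
have linL : step n (- n%:Z) (lin a f b g).
  split=> [x xn|x x' xn]; first by rewrite /lin fL.1// gL.1// !mulr0 addr0.
  by rewrite /lin fL.2// gL.2.
rewrite (kint_step nn linL sP) (kint_step nn fL sP) (kint_step nn gL sP).
rewrite /lin big_split /= -!mulr_sumr; ring.
Qed.

Lemma test_scale a f : test S f -> test S (fun x => a * f x).
Proof.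
move=> tf; rewrite (_ : (fun _ => _) = lin a f 0 f); first exact: test_lin.
by apply/funext => x; rewrite /lin mul0r addr0.
Qed.

Lemma kint_scale a f : test S f -> kint (fun x => a * f x) = a * kint f.
Proof.
move=> tf; rewrite (_ : (fun _ => _) = lin a f 0 f).
  by rewrite kint_lin// mul0r addr0.
by apply/funext => x; rewrite /lin mul0r addr0.
Qed.

Lemma test_mul f g : test S f -> test S g -> test S (fun x => f x * g x).
Proof.
move=> /step_testL[L fL] /step_testL[L' gL].
apply: (@test_stepT L (- (L + L')%N%:Z)); split=> [x xL|x x' xL].
  by rewrite fL.1 ?mul0r.
have xL1 : inball (- L%:Z) x' by apply: ball_le xL; lia.
have xL2 : inball (- L'%:Z) x' by apply: ball_le xL; lia.
by rewrite (fL.2 _ _ xL1) (gL.2 _ _ xL2).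
Qed.

Lemma kint0 : kint (fun _ : V => 0) = 0.
Proof.
have E : step 0 0 (fun _ : V => 0) by [].
by rewrite (kint_step (lexx 0) E (reps_refl 0)) big_seq1 mulr0.
Qed.

Lemma test0 : test S (fun _ : V => 0).
Proof. by apply: (@test_stepT 0 0). Qed.

Lemma kint_sum (I : eqType) (s : seq I) (c : I -> C) (g : I -> V -> C) :
  (forall i, i \in s -> test S (g i)) ->
  test S (fun x => \sum_(i <- s) c i * g i x) /\
  kint (fun x => \sum_(i <- s) c i * g i x) = \sum_(i <- s) c i * kint (g i).
Proof.
apply: linear_comb; [exact: test0|exact: test_lin|exact: kint_lin].
Qed.

(** If b lies in the large ball, translation by b carries one system of
    representatives to another. *)
Lemma kint_shift b f : test S f -> kint (fun y => f (b + y)) = kint f.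
Proof.
move=> /step_testL[L fL].
have [k bk] := ball_exhaust sdV b.
set n := (L + absz k)%N.
have {}fL : step n (- n%:Z) f by apply: step_le fL; rewrite /n; lia.
have {}bk : inball n b by apply: ball_le bk; rewrite /n; lia.
have nn : - n%:Z <= n%:Z by lia.
have [s sP] := reps_ex nn.
have E : step n (- n%:Z) (fun y => f (b + y)).
  split=> [x xn|x x' xn]; first by rewrite fL.1// ballDl.
  by rewrite addrA (fL.2 _ _ xn).
rewrite (kint_step nn E sP) (kint_step nn fL sP); congr (_ * _).
have -> : \sum_(r <- s) f (b + r) = \sum_(r <- [seq b + r | r <- s]) f r.
  by rewrite big_map.
exact: reps_sum fL.2 (reps_shift bk sP) sP.
Qed.

(** * Averages over balls and spectral components *)

(** The mean of g over the ball of radius q^m around x; on the Fourier side this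
    is the restriction to frequencies of norm at most q^(-m). *)
Definition avg m g x : C :=
  (vol m)^-1 * kint (fun y => (inball m y)%:R * g (x + y)).

Lemma cut_step m M g x : M <= m -> periodic M g ->
  step m M (fun y => (inball m y)%:R * g (x + y)).
Proof.
move=> Mm gM; split=> [y /negPf-> |y y' yM]; first by rewrite mul0r.
by rewrite addrA (gM _ _ yM) ballDr //; apply: ball_le yM.
Qed.

Lemma avg_sum m M g x s : M <= m -> periodic M g -> coset_reps m M s ->
  avg m g x = (vol m)^-1 * vol M * \sum_(r <- s) g (x + r).
Proof.
move=> Mm gM sP; rewrite /avg (kint_step Mm (cut_step x Mm gM) sP) mulrA.
congr (_ * _); rewrite big_seq [RHS]big_seq; apply: eq_bigr => r /(allP sP.1) -> .
by rewrite mul1r.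
Qed.

Lemma avg_id m g x : periodic m g -> avg m g x = g x.
Proof.
move=> gm; rewrite (avg_sum x (lexx m) gm (reps_refl m)).
by rewrite big_seq1 addr0 mulVf ?mul1r ?vol_neq0.
Qed.

Lemma avg_lin m M a f b g x : M <= m -> periodic M f -> periodic M g ->
  avg m (lin a f b g) x = a * avg m f x + b * avg m g x.
Proof.
move=> Mm fM gM; have [s sP] := reps_ex Mm.
have lM : periodic M (lin a f b g) by move=> y y' yM; rewrite /lin fM// gM.
rewrite !(avg_sum x Mm _ sP)// /lin big_split /= -!mulr_sumr; ring.
Qed.

Lemma avg_supported m N g : N <= m -> supported N g -> supported m (avg m g).
Proof.
move=> Nm g0 x xm; rewrite /avg (_ : (fun _ => _) = fun=> 0) ?kint0 ?mulr0//.
apply/funext => y; case: (boolP (inball m y)) => ym; rewrite ?mul0r//.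
rewrite g0 ?mulr0//; apply: contra xm => /(ball_le Nm).
by rewrite ballDr.
Qed.

Lemma avg_periodic m M g : periodic M g -> periodic M (avg m g).
Proof.
move=> gM x x' xM; congr (_ * _); apply: kint_ext => y.
by rewrite addrAC (gM _ _ xM).
Qed.

Lemma avg_periodic_self m M g : periodic M g -> periodic m (avg m g).
Proof.
move=> gM x x' xm; congr (_ * _).
have [mM|/ltW Mm] := leP m M; last first.
  rewrite -[RHS](kint_shift x' (f := fun y => (inball m y)%:R * g (x + y))).
    by apply: kint_ext => y; rewrite addrA ballDl.
  exact: test_stepT (cut_step x Mm gM).
apply: kint_ext => y; case: (boolP (inball m y)) => ym; rewrite ?mul0r//.
by rewrite addrAC (gM _ _ (ball_le mM xm)).
Qed.

(** Fubini for step functions: an exchange of two finite sums. *)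
Lemma avg_comm m m' M g x : periodic M g ->
  avg m (avg m' g) x = avg m' (avg m g) x.
Proof.
pose M' := Num.min M (Num.min m m') => gM0.
have [M'M M'm M'm'] : [/\ M' <= M, M' <= m & M' <= m'] by rewrite /M'; split; lia.
have gM : periodic M' g by move=> y y' /(ball_le M'M); apply: gM0.
have [s sP] := reps_ex M'm; have [s' s'P] := reps_ex M'm'.
rewrite (avg_sum x M'm (avg_periodic _ gM) sP).
rewrite (avg_sum x M'm' (avg_periodic _ gM) s'P).
under eq_bigr do rewrite (avg_sum _ M'm' gM s'P).
under [in RHS]eq_bigr do rewrite (avg_sum _ M'm gM sP).
rewrite -!mulr_sumr exchange_big /= mulrA [in RHS]mulrA; congr (_ * _); first by ring.
by apply: eq_bigr => r _; apply: eq_bigr => r' _; rewrite addrAC.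
Qed.

Lemma avg_avg m m' M g x : m' <= m -> periodic M g ->
  avg m (avg m' g) x = avg m g x.
Proof.
move=> mm' gM; rewrite (avg_comm _ _ _ gM) avg_id// => y y' ym.
by apply: avg_periodic_self gM _ _ _; apply: ball_le ym.
Qed.

Lemma kint_avg0 m N M g : N <= m -> step N M g -> kint g = vol m * avg m g 0.
Proof.
move=> Nm [g0 gM]; rewrite /avg mulrA mulfV ?vol_neq0// mul1r.
apply: kint_ext => y; rewrite add0r.
by case: (boolP (inball m y)) => ym; rewrite ?mul1r// mul0r g0//; apply: contra ym; apply: ball_le.
Qed.

Lemma avg_eq0 m M g x : step m M g -> kint g = 0 -> avg m g x = 0.
Proof.
move=> gmM g0; have [xm|xm] := boolP (inball m x); last first.
  exact: avg_supported (lexx m) gmM.1 _ xm.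
have : vol m * avg m g 0 = 0 by rewrite -(kint_avg0 (lexx m) gmM).
move=> /eqP; rewrite mulf_eq0 (negPf (vol_neq0 m)) /= => /eqP <-.
by rewrite -(avg_periodic_self gmM.2 0 xm) add0r.
Qed.

(** Functions whose Fourier transform is supported on the sphere of radius q^k.
    The invariance bounds the frequencies by q^k and the vanishing means exclude
    those of norm at most q^(k - 1). *)
Definition spectral k g : Prop :=
  [/\ test S g, periodic (- k) g & forall x, avg (1 - k) g x = 0].

(** The integral of g is the volume of a large ball times a mean of g over that
    ball, which factors through the vanishing means over smaller balls. *)
Lemma spectral_kint0 k g : spectral k g -> kint g = 0.
Proof.
move=> [/step_testL[L gL] gk g0].
have gL' : step (L%:Z + `|1 - k|) (- L%:Z) g by apply: step_le gL; lia.
rewrite (kint_avg0 (lexx _) gL') -(avg_avg (m' := 1 - k) _ _ gL.2); last by lia.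
have -> : avg (1 - k) g = fun=> 0 by apply/funext.
by rewrite avg_id ?mulr0.
Qed.

Lemma spectral_lizorkin k g : spectral k g -> lizorkin S g.
Proof. by move=> gk; split; [case: gk|apply: spectral_kint0 gk]. Qed.

Lemma spectral_lin k a f b g : spectral k f -> spectral k g ->
  spectral k (lin a f b g).
Proof.
move=> [tf fk f0] [tg gk g0]; split; first exact: test_lin.
  by move=> x x' xk; rewrite /lin fk// gk.
move=> x; rewrite (@avg_lin _ (- k)) ?f0 ?g0 ?mulr0 ?addr0//; lia.
Qed.

(** The component of frequency q^k. *)
Definition proj k g : V -> C := lin 1 (avg (- k) g) (-1) (avg (1 - k) g).

Lemma avg_test m g : test S g -> test S (avg m g).
Proof.
move=> /step_testL[L gL]; have gL' : step (L%:Z + `|m|) (- L%:Z) g by apply: step_le gL; lia.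
apply: (@test_stepT (L%:Z + `|m|) (- L%:Z)); split; last exact: avg_periodic gL.2.
move=> x xL; rewrite /avg (_ : (fun _ => _) = fun=> 0) ?kint0 ?mulr0//.
apply/funext => y; case: (boolP (inball m y)) => ym; rewrite ?mul0r//.
rewrite gL'.1 ?mulr0// ballDr//; apply: ball_le ym; lia.
Qed.

Lemma proj_spectral k g : test S g -> spectral k (proj k g).
Proof.
move=> tg; have [L gL] := (step_testL g).2 tg; split.
- by apply: test_lin; apply: avg_test.
- move=> x x' xk; rewrite /proj /lin !(avg_periodic_self gL.2)//.
  by apply: ball_le xk; lia.
- move=> x; have M1 : - L%:Z - `|k| <= 1 - k by lia.
  have gM : periodic (- L%:Z - `|k|) g by apply: periodic_le gL.2; lia.
  rewrite (avg_lin _ _ _ M1) ?(avg_avg _ _ gM); try exact: avg_periodic.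
  + by rewrite mul1r mulN1r subrr.
  + by [].
  + lia.
Qed.

(** The sum telescopes: means over balls of radius q^(-L) leave g unchanged, and
    means over a ball containing the support vanish. *)
Lemma proj_sum (L : nat) g : step L (- L%:Z) g -> kint g = 0 ->
  g = fun x => \sum_(i < (2 * L).+1) proj (i%:Z - L%:Z) g x.
Proof.
move=> gL g0; apply/funext => x.
transitivity (avg (- L%:Z) g x - avg (1 + L%:Z) g x).
  have gL' : step (1 + L%:Z) (- L%:Z) g by apply: step_le gL; lia.
  by rewrite (avg_id _ gL.2) (avg_eq0 _ gL') ?subr0.
pose h (i : nat) := avg (1 + L%:Z - i%:Z) g x.
rewrite -(big_mkord xpredT (fun i => proj (i%:Z - L%:Z) g x)).
under eq_bigr => i _.
  rewrite (_ : proj _ g x = h i.+1 - h i); first over.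
  by rewrite /h /proj /lin mul1r mulN1r; congr (avg _ g x - avg _ g x); lia.
by rewrite telescope_sumr// /h; congr (avg _ g x - avg _ g x); lia.
Qed.

(** * The Fourier transform of step functions *)

Lemma dotDr x y z : kdot x (y + z) = kdot x y + kdot x z :> K.
Proof. by rewrite !(dotC sdV x) (dotDl sdV). Qed.

Lemma dotNl x y : kdot (- x) y = - kdot x y :> K.
Proof.
apply/eqP; rewrite -addr_eq0 -(dotDl sdV) addNr.
by rewrite -(addrK (kdot 0 y) (kdot 0 y)) -(dotDl sdV) addr0 subrr.
Qed.

Lemma chi_dot_periodic k y x x' : inball k x' -> inball (- k) y ->
  chi (kdot (x + x') y) = chi (kdot x y).
Proof.
move=> xk yk; rewrite (dotDl sdV) (charD (chiP S)) (chi_dot1 sdV xk yk).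
by rewrite mulr1.
Qed.

Lemma chi_test g y : test S g -> test S (fun x => chi (kdot x y) * g x).
Proof.
move=> /step_testL[L gL]; have [k yk] := ball_exhaust sdV y.
apply: (@test_stepT L (- L%:Z - `|k|)); split=> [x xL|x x' xL].
  by rewrite gL.1 ?mulr0.
have xL' : inball (- L%:Z) x' by apply: ball_le xL; lia.
rewrite (gL.2 _ _ xL') (chi_dot_periodic _ xL)//.
by apply: ball_le yk; lia.
Qed.

(** Translating g by an element b of the ball of radius q^(-k) with
    chi (b . y) != 1 leaves g unchanged but multiplies its Fourier transform at y
    by chi (b . y). *)
Lemma fourier_out k g y : test S g -> periodic (- k) g -> ~~ inball k y ->
  fourier S g y = 0.
Proof.
move=> tg gk yk; have [|b bk b1] := chi_dot_neq1 sdV (k := - k) (y := y).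
  by rewrite opprK.
have E : fourier S g y = chi (kdot b y) * fourier S g y.
  have tc := chi_test y tg.
  rewrite {1}/fourier -(kint_shift b tc).
  rewrite (_ : (fun _ => _) = lin (chi (kdot b y)) (fun x => chi (kdot x y) * g x) 0 g).
    by rewrite kint_lin// mul0r addr0.
  apply/funext => x; rewrite /lin (dotDl sdV) (charD (chiP S)) (addrC b x) (gk _ _ bk).
  by rewrite mul0r addr0 mulrA.
apply/eqP; move/eqP: E; rewrite -subr_eq0 -{1}[fourier S g y]mul1r -mulrBl mulf_eq0.
by rewrite subr_eq0 eq_sym (negPf b1).
Qed.

(** On a coset of the ball of radius q^(-k), chi (x . y) is constant in x, so the
    transform is an integral of the means of g over these cosets. *)
Lemma fourier_in k g y : test S g -> (forall x, avg (- k) g x = 0) ->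
  inball k y -> fourier S g y = 0.
Proof.
move=> tg g0 yk; have [L gL] := (step_testL g).2 tg.
pose n := (L + absz k)%N.
pose h x := chi (kdot x y) * g x.
have [L' hL'] := (step_testL h).2 (chi_test y tg).
pose M := - (n%:Z + L'%:Z).
have gM : periodic M g by apply: periodic_le gL.2; lia.
have hM : step (n%:Z + L'%:Z) M h by apply: step_le hL'; lia.
have kM : M <= - k by rewrite /M; lia.
have [s sP] := reps_ex kM.
rewrite /fourier (kint_avg0 (lexx _) hM) -(avg_avg (m' := - k) _ _ hM.2); last by lia.
rewrite (_ : avg (- k) h = fun=> 0); first by rewrite avg_id ?mulr0.
apply/funext => x; rewrite (avg_sum x kM hM.2 sP).
rewrite (_ : \sum_(r <- s) h (x + r) = chi (kdot x y) * \sum_(r <- s) g (x + r)).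
  by rewrite mulrCA -(avg_sum x kM gM sP) g0 mulr0.
rewrite mulr_sumr big_seq [RHS]big_seq; apply: eq_bigr => r /(allP sP.1) rk.
by rewrite /h (chi_dot_periodic _ rk)// opprK.
Qed.

Lemma fourier_periodic N g y y' : supported N g -> inball (- N) y' ->
  fourier S g (y + y') = fourier S g y.
Proof.
move=> gN yN; apply: kint_ext => x; have [xN|/gN->] := boolP (inball N x); last by rewrite !mulr0.
by rewrite dotDr (charD (chiP S)) (chi_dot1 sdV xN yN) mulr1.
Qed.

(** Orthogonality of characters: up to normalization, the Fourier transform of
    the indicator of a ball is the indicator of the dual ball. *)
Lemma kint_chi_ball k N s y : coset_reps k (- N) s -> - N <= k -> inball N y ->
  \sum_(r <- s) chi (kdot r y) = vol k * vol N * (inball (- k) y)%:R.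
Proof.
move=> sP Nk yN.
pose g x : C := (inball k x)%:R.
have gk : step k (- N) g.
  split=> [x /negPf xk|x x' xN]; first by rewrite /g xk.
  by rewrite /g ballDr//; apply: ball_le xN.
have gk' : step k k g by split=> [|x x' xN]; [exact: gk.1|rewrite /g ballDr].
have tg := test_stepT gk.
have -> : \sum_(r <- s) chi (kdot r y) = vol N * fourier S g y.
  have E : step k (- N) (fun x => chi (kdot x y) * g x).
    split=> [x xk|x x' xN]; first by rewrite gk.1 ?mulr0.
    by rewrite (gk.2 _ _ xN) (chi_dot_periodic _ xN)// opprK.
  rewrite /fourier (kint_step Nk E sP) mulrA volVN mul1r.
  rewrite big_seq [RHS]big_seq; apply: eq_bigr => r /(allP sP.1) rk.
  by rewrite /g rk mulr1.
case: (boolP (inball (- k) y)) => yk.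
  rewrite /fourier (_ : (fun _ => _) = g).
    by rewrite (kint_step (lexx k) gk' (reps_refl k)) big_seq1 /g (ball0 sdV); ring.
  apply/funext => x; have [xk|xk] := boolP (inball k x).
    by rewrite (chi_dot1 sdV xk yk) mul1r.
  by rewrite gk.1// mulr0.
by rewrite (fourier_out (k := - k) tg) ?opprK ?mulr0//; case: gk'.
Qed.

(** Choosing n so large that g and its transform are both step functions for the
    balls of radii q^n and q^(-n) turns both integrals into sums over the same
    representatives, and orthogonality of characters applies. *)
Lemma fourier_inversion g : test S g -> inverse_fourier S (fourier S g) = g.
Proof.
move=> tg; apply/funext => y; have [k yk] := ball_exhaust sdV y.
have [L gL0] := (step_testL g).2 tg; pose n := (L + absz k)%N.
have gL : step n (- n%:Z) g by apply: step_le gL0; lia.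
have yn : inball n y by apply: ball_le yk; lia.
have nn : - n%:Z <= n%:Z by lia.
have [s sP] := reps_ex nn.
have E xi : inball n xi -> fourier S g xi = vol (- n%:Z) * \sum_(r <- s) chi (kdot r xi) * g r.
  move=> xin; apply: (kint_step nn _ sP); split=> [x xn|x x' xn].
    by rewrite gL.1 ?mulr0.
  by rewrite (gL.2 _ _ xn) (chi_dot_periodic _ xn)// opprK.
have E2 : step n (- n%:Z) (fun xi => chi (- kdot y xi) * fourier S g xi).
  split=> [xi xin|xi xi' xin]; first by rewrite (fourier_out tg gL.2)// mulr0.
  rewrite (fourier_periodic _ gL.1 xin) dotDr opprD (charD (chiP S)).
  rewrite -[- kdot y xi']dotNl (chi_dot1 sdV (k := n) _ xin) ?mulr1//.
  by rewrite (ballN sdV).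
rewrite /inverse_fourier (kint_step nn E2 sP).
transitivity (vol (- n%:Z) * vol (- n%:Z) *
    \sum_(r <- s) g r * \sum_(xi <- s) chi (kdot xi (r - y))).
  rewrite -mulrA; congr (_ * _); under [in RHS]eq_bigr do rewrite mulr_sumr.
  rewrite exchange_big mulr_sumr big_seq [RHS]big_seq; apply: eq_bigr => xi.
  move=> /(allP sP.1) xin; rewrite E// mulrCA; congr (_ * _).
  rewrite mulr_sumr; apply: eq_bigr => r _.
  rewrite [kdot xi _](dotC sdV) (dotDl sdV) dotNl (charD (chiP S)); ring.
have -> : \sum_(r <- s) g r * \sum_(xi <- s) chi (kdot xi (r - y)) =
    vol n * vol n * \sum_(r <- s) (inball (- n%:Z) (y - r))%:R * g y.
  rewrite mulr_sumr big_seq [RHS]big_seq; apply: eq_bigr => r /(allP sP.1) rn.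
  rewrite (kint_chi_ball sP nn (ballB rn yn)).
  have -> : inball (- n%:Z) (r - y) = inball (- n%:Z) (y - r).
    by rewrite -(ballN sdV) opprB.
  have [ryn|_] := boolP (inball (- n%:Z) (y - r)); last by rewrite /= !mulr0 mul0r mulr0.
  have -> : g r = g y by rewrite -(gL.2 r _ ryn) addrC subrK.
  by rewrite /= !mulr1 mul1r; ring.
rewrite -mulr_suml -count_sum sP.2// mul1r.
rewrite mulrA [X in X * _](_ : _ = (vol n * vol (- n%:Z)) ^+ 2); last by ring.
by rewrite volVN expr1n mul1r.
Qed.

(** On the support of the Fourier transform of g the symbol is the constant
    q^(k alpha). *)
Lemma spectral_fracD k alpha g : spectral k g ->
  fracD S alpha g = fun x => ((q ^ k) `^ alpha)%:C * g x.
Proof.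
move=> gk; have [tg gp g0] := gk.
have E : (fun xi => (knorm xi `^ alpha)%:C * fourier S g xi) =
    fourier S (fun x => ((q ^ k) `^ alpha)%:C * g x).
  apply/funext => xi; transitivity (((q ^ k) `^ alpha)%:C * fourier S g xi).
    have [xik|xik] := boolP (inball k xi); last by rewrite (fourier_out tg gp)// !mulr0.
    have [xik'|xik'] := boolP (inball (k - 1) xi); last by rewrite (sphere_norm sdV xik).
    rewrite (fourier_in tg _ xik') ?mulr0// => x; by rewrite opprB.
  rewrite /fourier -(kint_scale _ (chi_test xi tg)); apply: kint_ext => x.
  by rewrite mulrCA.
by rewrite /fracD E fourier_inversion//; apply: test_scale.
Qed.

End Averages.

(** * The line K *)

Section TestTopology.
Context (R : realType) (K : nonArchLocalFieldType) (S : local_field_data R K).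
Variable V : kspace R K.
Local Notation q := ((resq S)%:R : R).
Local Notation inball := (@inball R K S V).

(** A compact set lies in a ball because the balls around 0 form an increasing
    open cover; conversely, the support of a step function lies in a compact
    ball. *)
Lemma test_step_topology :
  (forall x : V, exists k, inball k x) ->
  (forall k (x : V), nbhs x [set y | inball k (y - x)]) ->
  (forall k, compact [set x | inball k x]) ->
  (forall k x y, inball k x -> inball k y -> inball k (x + y)) ->
  (forall k x, inball k (- x) = inball k x) ->
  forall f : V -> R[i], test S f <-> exists N M, step S N M f.
Proof.
move=> exh nb co bD bN f; split=> [[[A cA fA] [l fl]]|[N [M [fN fM]]]].
  have : near_covering A by apply/compact_near_coveringP.
  move=> /(_ nat \oo (fun n x => inball n%:Z x) _)[].
    move=> x _; have [k xk] := exh x.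
    exists ([set y | inball k (y - x)], [set n | (absz k <= n)%N]) => /=.
      by split; [exact: nb|exists (absz k)].
    move=> [y n] /= [yx kn]; rewrite -(subrK x y); apply: (ball_le (k := k)); first lia.
    exact: bD.
  move=> N _ AN; exists N, (- l); split=> [x xN|x x' xl]; last by apply: fl.
  by apply: fA => xA; move: xN; rewrite (AN N _ x xA)//=.
split; last by exists (- M) => x x'; rewrite opprK; apply: fM.
by exists [set x | inball N x] => // x /negP; apply: fN.
Qed.

End TestTopology.

Section Line.
Context (R : realType) (K : nonArchLocalFieldType) (S : local_field_data R K).
Local Notation C := R[i].
Local Notation q := ((resq S)%:R : R).
Local Notation ab := (absv S).
Local Notation inball := (@inball R K S (line S)).
Local Notation coset_reps := (@coset_reps R K S (line S)).
Implicit Types (x y a c : K) (k m N M : int).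

Let q_gt1 : 1 < q := resq_gt1 S.
Let q_gt0 : 0 < q. Proof. exact: lt_trans q_gt1. Qed.
Let q_neq0 : q != 0. Proof. exact: lt0r_neq0. Qed.

(** Powers of a uniformizer. *)
Lemma abs_scalar k : exists c, ab c = q ^ k.
Proof.
have [p Hp] := absval_uniformizer (absvP S).
have pn n : ab (p ^+ n) = q ^ (- n%:Z).
  rewrite -invr_expz -exprVn -Hp; elim: n => [|n IH]; first by rewrite !expr0 abs1.
  by rewrite !exprS absM IH.
case: k => n; last by exists (p ^+ n.+1); rewrite pn.
by exists (p ^+ n)^-1; rewrite absV pn -invr_expz invrK.
Qed.

Lemma lballE k x : inball k x = (ab x <= q ^ k). Proof. by []. Qed.

Lemma lball0 k : inball k 0.
Proof. by rewrite lballE abs0 exprz_ge0 // ltW. Qed.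

Lemma lballD k x y : inball k x -> inball k y -> inball k (x + y).
Proof.
rewrite !lballE => xk yk; apply: le_trans (absvalD (absvP S) x y) _.
by rewrite ge_max xk.
Qed.

Lemma lballN k x : inball k (- x) = inball k x.
Proof. by rewrite !lballE absN. Qed.

Lemma abs_sphere k x : inball k x -> ~~ inball (k - 1) x -> ab x = q ^ k.
Proof.
have [->|x0] := eqVneq x 0; first by rewrite (lball0 (k - 1)).
have [j xj] := absval_values (absvP S) x0.
rewrite !lballE xj !ler_eXz2l// => jk kj; by have -> : j = k by lia.
Qed.

Lemma lballM k j c x : ab c = q ^ j -> inball k (c * x) = inball (k - j) x.
Proof.
move=> cj; rewrite !lballE absM cj expfzDr// -invr_expz mulrC.
by rewrite ler_pdivlMr ?exprz_gt0.
Qed.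

Lemma lball_exhaust x : exists k, inball k x.
Proof.
have [->|/(absval_values (absvP S))[k xk]] := eqVneq x 0; first by exists 0; apply: lball0.
by exists k; rewrite lballE xk.
Qed.

Lemma small_ball (eps : R) : 0 < eps -> exists k : int, q ^ k < eps.
Proof.
move=> e0; pose n := (Num.trunc eps^-1).+1.
exists (- n%:Z); rewrite -invr_expz -[ltRHS]invrK ltf_pV2 ?posrE ?exprz_gt0 ?invr_gt0//.
apply: lt_le_trans (truncnS_gt _) _; rewrite -exprnP -/n.
have : n%:R <= 2%:R ^+ n :> R by rewrite -natrX ler_nat ltnW// ltn_expl.
move=> /le_trans; apply; apply: lerXn2r; rewrite ?nnegrE ?ler0n//.
by rewrite ler_nat -(ltr_nat R).
Qed.

Lemma nbhs_lball x (A : set K) :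
  nbhs x A <-> exists k, [set y | inball k (y - x)] `<=` A.
Proof.
split=> [xA|[k kA]].
  have c0 : {for 0, continuous (fun y : K => x + y)}.
    apply: (@continuous_comp _ _ _ (fun y : K => (x, y)) (fun z : K * K => z.1 + z.2)).
      by apply: cvg_pair => /=; [exact: cvg_cst|exact: cvg_id].
    exact: add_continuous.
  have : nbhs (0 : K) [set y | A (x + y)] by apply: c0; rewrite addr0.
  move=> /(absval_topology (absvP S))[eps e0 eA]; have [k ke] := small_ball e0.
  exists k => y /= yx; rewrite -(subrK x y) addrC; apply: eA => /=.
  exact: le_lt_trans ke.
have cx : {for x, continuous (fun y : K => y - x)}.
  apply: (@continuous_comp _ _ _ (fun y : K => (y, x)) (fun z : K * K => z.1 - z.2)).
    by apply: cvg_pair => /=; [exact: cvg_id|exact: cvg_cst].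
  exact: sub_continuous.
have : nbhs (x - x) [set y | inball k y].
  rewrite subrr; apply/(absval_topology (absvP S)); exists (q ^ k); first exact: exprz_gt0.
  by move=> y /= /ltW.
move=> /cx cA; have {}cA : nbhs x [set y | inball k (y - x)] by exact: cA.
exact: filterS cA.
Qed.

Lemma lball_nbhs k x : nbhs x [set y | inball k (y - x)].
Proof. by apply/nbhs_lball; exists k. Qed.

Lemma lballBC k x y : inball k (x - y) = inball k (y - x).
Proof. by rewrite -lballN opprB. Qed.

Lemma lball_open k x : open [set y : K | inball k (y - x)].
Proof.
rewrite openE => y /= yk; apply/nbhs_lball; exists k => z /= zk.
by rewrite -(subrK y z) -addrA; apply: lballD.
Qed.

Lemma lball_closed k : closed [set y : K | inball k y].
Proof.
rewrite -openC openE => y /= yk; apply/nbhs_lball; exists k => z /= zk zk'.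
apply: yk; rewrite -(subrK z y); apply: lballD => //.
by rewrite lballBC.
Qed.

(** Some ball lies in a compact neighbourhood of 0, and multiplication by a
    scalar is a homeomorphism between any two balls. *)
Lemma lball_compact k : compact [set y : K | inball k y].
Proof.
have [U U0 [cU clU]] := nonarch_locally_compact (0 : K) I.
have [m mU] : exists m, [set y | inball m y] `<=` U.
  have [m mU] := (nbhs_lball 0 U).1 (filterS (fun y yU => yU I) U0).
  by exists m => y ym; apply: mU => //=; rewrite subr0.
have cm : compact [set y : K | inball m y].
  exact: subclosed_compact (@lball_closed m) cU mU.
have [c ck] := abs_scalar (k - m).
have c0 : c != 0 by rewrite -(abs_eq0 S) ck expfz_neq0.
have cc : continuous (fun y : K => c * y).
  move=> x A /nbhs_lball[j jA]; apply/nbhs_lball; exists (j - (k - m)) => y /= yx.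
  by apply: jA => /=; rewrite -mulrBr (lballM _ _ ck).
have cE y : inball k (c * y) = inball m y.
  by rewrite (lballM _ _ ck) (_ : k - (k - m) = m) //; ring.
rewrite (_ : [set y | _] = [set c * y | y in [set y | inball m y]]).
  by apply: continuous_compact cm; apply: continuous_subspaceT.
apply/seteqP; split=> [y /= yk|_ [y /= ym <-]]; last by rewrite cE.
by exists (c^-1 * y); rewrite ?mulVKf// -cE mulVKf.
Qed.

(** Representatives of the residue field, multiplied by a scalar of absolute
    value q^k. *)
Lemma reps_step k : exists r : 'I_(resq S) -> K,
  coset_reps k (k - 1) [seq r i | i <- enum 'I_(resq S)].
Proof.
have [r [r1 r2 r3]] := absval_residue (absvP S).
have [c ck] := abs_scalar k.
have c0 : c != 0 by rewrite -(abs_eq0 S) ck expfz_neq0.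
have lt1 x : inball (-1) x = (ab x < 1).
  rewrite lballE; apply/idP/idP => [/le_lt_trans|x1]; first apply.
    by rewrite -[-1]/(- (1%:Z)) -invr_expz invf_lt1 ?expr1z.
  rewrite leNgt; apply/negP => x2.
  have : ab x = q ^ 0 by apply: abs_sphere; rewrite ?sub0r lballE ?expr0z -?ltNge// ltW.
  by move=> E; rewrite E expr0z ltxx in x1.
exists (fun i => c * r i); split.
  apply/allP => _ /mapP[i _ ->].
  by rewrite (lballM _ _ ck) subrr lballE expr0z.
move=> x xk; have : inball 0 (c^-1 * x).
  rewrite -(subrr k) -(lballM k _ ck) mulVKf//.
rewrite lballE expr0z => /r3[i xi].
have E j : inball (k - 1) (x - c * r j) = (ab (c^-1 * x - r j) < 1).
  by rewrite -lt1 -[x in LHS](mulVKf c0) -mulrBr (lballM _ _ ck); congr inball; ring.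
rewrite count_map (eq_count (a2 := pred1 i)).
  by rewrite count_uniq_mem ?enum_uniq// mem_enum.
move=> j /=; rewrite E; apply/idP/eqP => [xj|->//]; apply: r2.
rewrite -lt1 (_ : r j - r i = (c^-1 * x - r i) - (c^-1 * x - r j)); last by ring.
by apply: lballD; rewrite ?lballN lt1.
Qed.

Lemma reps_trans N M M' s s' : M <= N -> M' <= M ->
  coset_reps N M s -> coset_reps M M' s' ->
  coset_reps N M' [seq x + y | x <- s, y <- s'].
Proof.
move=> MN M'M [sN s1] [s'M s'1]; split.
  apply/allP => _ /allpairsP[[x y] /= [xs ys ->]]; apply: lballD.
    by have /allP := sN; apply.
  by apply: ball_le MN _; have /allP := s'M; apply.
move=> x xN; rewrite -sum1_count big_mkcond big_allpairs_dep /=.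
rewrite -[RHS](s1 x xN) -sum1_count [RHS]big_mkcond; apply: eq_bigr => r _.
case: ifPn => xr; rewrite -big_mkcond sum1_count.
  rewrite -(s'1 _ xr); apply: eq_count => r' /=; by rewrite opprD addrA.
apply/eqP; rewrite -leqn0 leqNgt -has_count; apply: contra xr => /hasP[r' r's' /=].
rewrite opprD addrA => xr; rewrite -(subrK r' (x - r)); apply: lballD.
  exact: ball_le M'M xr.
by have /allP := s'M; apply.
Qed.

Lemma lreps_ex N M : M <= N -> exists s, coset_reps N M s.
Proof.
move=> MN; rewrite (_ : N = M + `|N - M|%N); last by lia.
elim: `|N - M|%N => [|n [s sP]].
  exists [:: 0]; rewrite addr0; split=> [|x xM] /=; first by rewrite lball0.
  by rewrite subr0 xM.
have [r rP] := reps_step (M + n.+1%:Z).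
have E : M + n.+1%:Z - 1 = M + n by lia.
rewrite E in rP; eexists; apply: reps_trans rP sP; lia.
Qed.

Local Notation mu := (haar S).
Local Notation ballset m := ([set x : K | inball m x] : set (borel K)).

Lemma ball_measurable k a : measurable ([set x : K | inball k (x - a)] : set (borel K)).
Proof. by apply: sub_sigma_algebra; apply: lball_open. Qed.

Lemma haar_ball_shift k a :
  mu ([set x : K | inball k (x - a)] : set (borel K)) = mu (ballset k).
Proof.
have mk : measurable (ballset k).
  by rewrite (_ : ballset k = [set x : K | inball k (x - 0)]);
    [exact: ball_measurable|apply/seteqP; split=> x /=; rewrite subr0].
rewrite -(haar_invariant (haarP S) a mk); congr (mu _).
apply/seteqP; split=> [x /= xk|_ [y /= yk <-]]; last by rewrite addrC addKr.
by exists (x - a) => //; rewrite addrC subrK.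
Qed.

Lemma haar_ball_fin k : mu (ballset k) = (fine (mu (ballset k)))%:E.
Proof.
rewrite fineK// ge0_fin_numE ?measure_ge0//; apply: (haar_compact (haarP S)).
exact: lball_compact.
Qed.

(** A ball is the disjoint union of q translates of the next smaller one. *)
Lemma haar_ball_step k : fine (mu (ballset k)) = q * fine (mu (ballset (k - 1))).
Proof.
have [r [rk r1]] := reps_step k.
pose B (i : 'I_(resq S)) := [set x : K | inball (k - 1) (x - r i)] : set (borel K).
have -> : ballset k = \big[setU/set0]_(i < resq S) B i.
  rewrite -bigcup_seq; apply/seteqP; split=> [x /= /r1 xk|x /= [i _ xi]].
    have : has (fun a => inball (k - 1) (x - a)) [seq r i | i <- enum 'I_(resq S)].
      by rewrite has_count xk.
    by move=> /hasP[_ /mapP[i _ ->] xi]; exists i => //=; apply: mem_index_enum.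
  rewrite -(subrK (r i) x); apply: lballD; first by apply: ball_le xi; lia.
  by have /allP := rk; apply; apply: map_f; rewrite mem_enum.
rewrite (measure_semi_additive_ord mu).
- rewrite (eq_bigr (fun _ => (fine (mu (ballset (k - 1))))%:E)); last first.
    by move=> i _; rewrite -haar_ball_fin; apply: haar_ball_shift.
  by rewrite sumEFin /= sumr_const card_ord mulr_natl.
- by move=> i; apply: ball_measurable.
- apply/trivIsetP => i j _ _ ij; apply/seteqP; split=> // x [/= xi xj].
  have ri : inball k (r i) by have /allP := rk; apply; apply: map_f; rewrite mem_enum.
  have xk : inball k x.
    by rewrite -(subrK (r i) x); apply: lballD => //; apply: ball_le xi; lia.
  have := r1 _ xk; rewrite count_map.
  rewrite (eq_count (a2 := fun i0 => inball (k - 1) (x - r i0)))// -size_filter => s1.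
  have mem_s i0 : inball (k - 1) (x - r i0) ->
      i0 \in [seq i0 <- enum 'I_(resq S) | inball (k - 1) (x - r i0)].
    by move=> xi0; rewrite mem_filter xi0 mem_enum.
  move: (mem_s i xi) (mem_s j xj) ij s1.
  case: [seq _ <- _ | _] => [|a [|b t]] //=; rewrite !inE => /eqP-> /eqP->.
  by rewrite eqxx.
- by apply: bigsetU_measurable => i _; apply: ball_measurable.
Qed.

Lemma haar_ball k : mu (ballset k) = (q ^ k)%:E.
Proof.
pose m j := fine (mu (ballset j)).
have ms j : m j = q * m (j - 1) by apply: haar_ball_step.
have m0 : m 0 = 1.
  have B0 : ballset 0 = [set x | ab x <= 1].
    by apply/seteqP; split=> x /=; rewrite lballE expr0z.
  by rewrite /m B0 (haar_unit (haarP S)).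
rewrite haar_ball_fin -/(m k); congr EFin; elim/int_rec: k => [|n IH|n IH]; first by rewrite m0.
  by rewrite ms (_ : n.+1%:Z - 1 = n) ?IH ?exprSz//; lia.
have E : - n.+1%:Z = - n%:Z - 1 by lia.
apply: (mulfI q_neq0); rewrite E -ms IH expfzDr// mulrCA.
by rewrite exprN1 mulfV ?mulr1.
Qed.

Lemma integrable_indic_fin (A : set (borel K)) : measurable A -> (mu A < +oo)%E ->
  mu.-integrable setT (EFin \o (\1_A : borel K -> R)).
Proof.
move=> mA fA; apply/integrableP; split.
  exact/measurable_realfun.measurable_EFinP/measurable_realfun.measurable_indic.
rewrite (eq_integral (fun x : borel K => (\1_A x)%:E)); last first.
  by move=> t _; rewrite gee0_abs// lee_fin.
by rewrite integral_indic// setIT.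
Qed.

Lemma Rintegral_balls (s : seq K) (c : K -> R) M :
  mu.-integrable setT (EFin \o (fun x : borel K => \sum_(r <- s) c r * (inball M ((x : K) - r))%:R))
  /\ Rintegral mu setT (fun x : borel K => \sum_(r <- s) c r * (inball M ((x : K) - r))%:R)
   = q ^ M * \sum_(r <- s) c r.
Proof.
elim: s => [|a s [IH1 IH2]].
  rewrite (_ : (fun _ => _) = cst 0); last by apply/funext => x; rewrite big_nil.
  rewrite big_nil mulr0; split; first exact: integrable0.
  by rewrite /Rintegral integral0.
pose A := [set x : K | inball M (x - a)] : set (borel K).
have mA : mu A = (q ^ M)%:E by rewrite /A haar_ball_shift haar_ball.
have iA : mu.-integrable setT (EFin \o (\1_A : borel K -> R)).
  by apply: integrable_indic_fin; [exact: ball_measurable|rewrite mA ltry].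
have icA : mu.-integrable setT (EFin \o (fun x : borel K => c a * \1_A x)).
  exact: (integrableZl measurableT (c a) iA).
have E : (fun x : borel K => \sum_(r <- (a :: s)) c r * (inball M ((x : K) - r))%:R) =
  (fun x : borel K => c a * \1_A x + \sum_(r <- s) c r * (inball M ((x : K) - r))%:R).
  apply/funext => x; rewrite big_cons indicE.
  rewrite (_ : (x \in A) = inball M ((x : K) - a))//.
  by apply/idP/idP; rewrite inE.
rewrite E; split; first by have := integrableD measurableT icA IH1.
rewrite RintegralD// IH2 big_cons mulrDr; congr (_ + _).
rewrite RintegralZl// mulrC; congr (_ * _).
by rewrite /Rintegral integral_indic ?setIT ?mA//; exact: ball_measurable.
Qed.

(** A step function is a linear combination of indicators of balls of radius
    q^M, one for each representative. *)
Lemma integral1_step N M (f : K -> C) s : step S (V := line S) N M f ->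
  coset_reps N M s ->
  Defs.integral1 S f = vol S 1 M * \sum_(r <- s) f r.
Proof.
move=> [f0 fM] [sN s1].
have fE x : f x = \sum_(r <- s) f r * (inball M (x - r))%:R.
  have [xN|xN] := boolP (inball N x); last first.
    rewrite f0// big_seq big1// => r rs; have /allP/(_ r rs) rN := sN.
    have [xr|_] := boolP (inball M (x - r)); last by rewrite mulr0.
    by rewrite -(f0 x xN) -[in RHS](subrK r x) addrC fM// ?mulr1.
  transitivity (f x * \sum_(r <- s) (inball M (x - r))%:R).
    by rewrite -count_sum s1// mulr1.
  rewrite mulr_sumr; apply: eq_bigr => r _.
  have [xr|_] := boolP (inball M (x - r)); last by rewrite !mulr0.
  by rewrite -[in LHS](subrK r x) addrC fM.
have ReE x : complex.Re (f x) = \sum_(r <- s) complex.Re (f r) * (inball M (x - r))%:R.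
  rewrite {1}fE; elim: s {sN s1 fE} => [|a s IH]; first by rewrite !big_nil.
  rewrite !big_cons -IH.
  case: (f a) (\sum_(r <- s) _) => [u v] [z w] /=; case: inball => /=; ring.
have ImE x : complex.Im (f x) = \sum_(r <- s) complex.Im (f r) * (inball M (x - r))%:R.
  rewrite {1}fE; elim: s {sN s1 fE ReE} => [|a s IH]; first by rewrite !big_nil.
  rewrite !big_cons -IH.
  case: (f a) (\sum_(r <- s) _) => [u v] [z w] /=; case: inball => /=; ring.
rewrite /Defs.integral1 (funext ReE) (funext ImE) !(Rintegral_balls _ _ _).2.
rewrite /vol expr1; elim: s {sN s1 fE ReE ImE} => [|a s IH].
  by rewrite !big_nil !mulr0.
rewrite !big_cons [RHS]mulrDr -IH; case: (f a) => [u v] /=; simpc.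
by congr (_ +i* _); rewrite mulrDr.
Qed.

Lemma chi0 : chi S 0 = 1.
Proof. by apply: (char_trivial (chiP S)); rewrite abs0. Qed.

Lemma chi_ball k x y : inball k x -> inball (- k) y -> chi S (x * y) = 1.
Proof.
move=> xk yk; apply: (char_trivial (chiP S)); rewrite absM.
have -> : 1 = q ^ k * q ^ (- k) by rewrite -expfzDr// subrr.
by apply: ler_pM => //; apply: (absval_ge0 (absvP S)).
Qed.

(** A point x0 of norm q with chi x0 != 1 gives b = x0 / y. *)
Lemma chi_out k y : ~~ inball (- k) y -> exists2 b, inball k b & chi S (b * y) != 1.
Proof.
move=> yk; have y0 : y != 0 by apply: contra yk => /eqP->; rewrite lball0.
have [j yj] := absval_values (absvP S) y0.
have [x0 [x0q x01]] := char_rank (chiP S).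
exists (x0 / y); last by rewrite divfK.
move: yk; rewrite !lballE yj ler_eXz2l// => jk.
rewrite absM absV x0q yj -[X in X / _]expr1z invr_expz -expfzDr// ler_eXz2l//; lia.
Qed.

Lemma line_selfdual : selfdual S (line S) 1.
Proof.
split.
- exact: lball0.
- exact: lballD.
- exact: lballN.
- exact: lball_exhaust.
- move=> k; have [c ck] := abs_scalar (k + 1); exists c.
  by rewrite lballE ck ler_eXz2l//; lia.
- exact: abs_sphere.
- by move=> x y z; rewrite /= mulrDl.
- by move=> x y; rewrite /= mulrC.
- exact: chi_ball.
- exact: chi_out.
- move=> N M MN; have [s sP] := lreps_ex MN; exists s => // f fNM.
  exact: integral1_step fNM sP.
- apply: test_step_topology.
  + exact: lball_exhaust.
  + by move=> k x; apply: lball_nbhs.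
  + exact: lball_compact.
  + exact: lballD.
  + exact: lballN.
Qed.

End Line.

(** * The space K^n *)

(** The compactness theorem for products of row vectors is stated for pointed
    spaces; this copy of K carries the point 0. *)
Definition pointed_top (K : nonArchLocalFieldType) : Type := K.
HB.instance Definition _ (K : nonArchLocalFieldType) :=
  Topological.on (pointed_top K).
HB.instance Definition _ (K : nonArchLocalFieldType) :=
  isPointed.Build (pointed_top K) (0 : K).

Section Affine.
Context (R : realType) (K : nonArchLocalFieldType) (S : local_field_data R K).
Local Notation C := R[i].
Local Notation q := ((resq S)%:R : R).
Local Notation lball := (@inball R K S (line S)).
Local Notation ball n := (@inball R K S (affine S n)).
Local Notation lreps := (@coset_reps R K S (line S)).
Local Notation reps n := (@coset_reps R K S (affine S n)).
Implicit Types (n : nat) (k m N M : int).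

Let q_gt1 : 1 < q := resq_gt1 S.
Let q_gt0 : 0 < q. Proof. exact: lt_trans q_gt1. Qed.
Let q_neq0 : q != 0. Proof. exact: lt0r_neq0. Qed.

Lemma ball_coordP n k (x : 'rV[K]_n) :
  reflect (forall j, lball k (x 0 j)) (ball n k x).
Proof.
apply: (iffP idP) => [/bigmax_leP[_ xk] j|xk]; first exact: xk.
by apply/bigmax_leP; split=> [|j _]; [rewrite exprz_ge0 ?ltW|exact: xk].
Qed.

Lemma aball0 n k : ball n k 0.
Proof. by apply/ball_coordP => j; rewrite mxE; apply: lball0. Qed.

Lemma aballD n k (x y : 'rV[K]_n) : ball n k x -> ball n k y -> ball n k (x + y).
Proof.
by move=> /ball_coordP xk /ball_coordP yk; apply/ball_coordP => j; rewrite mxE; apply: lballD.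
Qed.

Lemma aballN n k (x : 'rV[K]_n) : ball n k (- x) = ball n k x.
Proof.
by apply/ball_coordP/ball_coordP => xk j; move: (xk j); rewrite mxE lballN.
Qed.

Lemma aball_exhaust n (x : 'rV[K]_n) : exists k, ball n k x.
Proof.
have kx j : {k | lball k (x 0 j)} by apply: cid; apply: lball_exhaust.
exists (\sum_j `|projT1 (kx j)|%N)%N; apply/ball_coordP => j.
apply: ball_le (projT2 (kx j)); rewrite (bigD1 j)//=; lia.
Qed.

Lemma aball_proper n k : (0 < n)%N -> exists x : 'rV[K]_n, ~~ ball n k x.
Proof.
move=> n0; have [x xk] := ball_proper (line_selfdual S) k.
exists (const_mx x); apply: contra xk => /ball_coordP/(_ (Ordinal n0)).
by rewrite mxE.
Qed.

Lemma normn_sphere n k (x : 'rV[K]_n) : ball n k x -> ~~ ball n (k - 1) x ->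
  normn S x = q ^ k.
Proof.
move=> xk xk'; apply/eqP; rewrite eq_le; apply/andP; split => //.
have : ~ forall j, lball (k - 1) (x 0 j) by move=> /ball_coordP; apply/negP.
move=> /existsNP[j /negP xj]; have /ball_coordP/(_ j) xkj := xk.
by rewrite -(abs_sphere xkj xj) /normn; apply: (le_bigmax _ (fun j => absv S (x 0 j))).
Qed.

Lemma chi_sum (I : Type) (s : seq I) (F : I -> K) :
  chi S (\sum_(i <- s) F i) = \prod_(i <- s) chi S (F i).
Proof. exact: (big_morph _ (charD (chiP S)) (chi0 S)). Qed.

Lemma dotn_chi1 n k (x y : 'rV[K]_n) : ball n k x -> ball n (- k) y ->
  chi S (dotn x y) = 1.
Proof.
move=> /ball_coordP xk /ball_coordP yk; rewrite chi_sum big1// => j _.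
exact: chi_ball.
Qed.

Lemma dotn_chi_neq1 n k (y : 'rV[K]_n) : ~~ ball n (- k) y ->
  exists2 b : 'rV[K]_n, ball n k b & chi S (dotn b y) != 1.
Proof.
move=> yk; have : ~ forall j, lball (- k) (y 0 j) by move=> /ball_coordP; apply/negP.
move=> /existsNP[j /negP yj]; have [b bk b1] := chi_out yj.
exists (\row_i (b *+ (i == j))).
  apply/ball_coordP => i; rewrite mxE; case: eqP => _ //; exact: lball0.
rewrite /dotn (bigD1 j)//= mxE eqxx mulr1n big1 ?addr0// => i ij.
by rewrite mxE (negPf ij) mulr0n mul0r.
Qed.

Lemma ball_row_mx n k (x : K) (y : 'rV[K]_n) :
  ball n.+1 k (row_mx (x%:M : 'rV[K]_1) y) = lball k x && ball n k y.
Proof.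
have El : (row_mx (x%:M : 'rV[K]_1) y : 'rV[K]_n.+1) 0 (@lshift 1 n 0) = x.
  by have := @row_mxEl K 1 1 n x%:M y 0 0; rewrite [in RHS]mxE eqxx.
have Er j : (row_mx (x%:M : 'rV[K]_1) y : 'rV[K]_n.+1) 0 (@rshift 1 n j) = y 0 j.
  exact: (@row_mxEr K 1 1 n).
apply/ball_coordP/andP => [xyk|[xk /ball_coordP yk] j].
  split; first by have := xyk (@lshift 1 n 0); rewrite El.
  by apply/ball_coordP => j; have := xyk (@rshift 1 n j); rewrite Er.
rewrite -[j](@splitK 1 n); case: (@fintype.split 1 n j) => i /=; last by rewrite Er.
by rewrite (ord1 i) El.
Qed.

Lemma row_mx_first n (v : 'rV[K]_n.+1) :
  exists x (y : 'rV[K]_n), v = row_mx (x%:M : 'rV[K]_1) y.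
Proof.
exists (@lsubmx _ 1 1 n v 0 0), (@rsubmx _ 1 1 n v).
by rewrite -[LHS](@hsubmxK _ 1 1 n) -mx11_scalar.
Qed.

Lemma row_mxB n (x x' : K) (y y' : 'rV[K]_n) :
  row_mx (x%:M : 'rV[K]_1) y - row_mx (x'%:M : 'rV[K]_1) y' =
  row_mx ((x - x')%:M : 'rV[K]_1) (y - y').
Proof. by rewrite opp_row_mx add_row_mx -raddfB. Qed.

Lemma row_mxD n (x x' : K) (y y' : 'rV[K]_n) :
  row_mx ((x + x')%:M : 'rV[K]_1) (y + y') =
  row_mx (x%:M : 'rV[K]_1) y + row_mx (x'%:M : 'rV[K]_1) y'.
Proof. by rewrite add_row_mx -raddfD. Qed.

Lemma reps_row_mx n N M s s' : lreps N M s -> reps n N M s' ->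
  reps n.+1 N M [seq row_mx (x%:M : 'rV[K]_1) y | x <- s, y <- s'].
Proof.
move=> [sN s1] [s'N s'1]; split.
  apply/allP => _ /allpairsP[[x y] /= [xs ys ->]]; rewrite ball_row_mx.
  by apply/andP; split; [have /allP := sN; apply|have /allP := s'N; apply].
move=> v; have [x [y ->]] := row_mx_first v; rewrite ball_row_mx => /andP[xN yN].
rewrite -sum1_count big_mkcond big_allpairs_dep /=.
rewrite -[RHS](s1 x xN) -sum1_count [RHS]big_mkcond; apply: eq_bigr => r _.
rewrite -big_mkcond sum1_count; under eq_count do rewrite row_mxB ball_row_mx.
case: (lball M (x - r)); last by rewrite /= count_pred0.
exact: s'1.
Qed.

(** The inner integrand is again a step function with the same exponents, in the
    remaining variables as well as in the first one. *)
Lemma integraln_step n N M : M <= N -> exists2 s, reps n N M s &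
  forall f, step S (V := affine S n) N M f ->
    integraln S f = vol S n M * \sum_(r <- s) f r.
Proof.
move=> MN; elim: n => [|n [s' s'P IH]].
  exists [:: 0] => [|f _].
    have x0 k (x : 'rV[K]_0) : ball 0 k x by apply/ball_coordP => -[].
    by split=> [|x _] /=; rewrite !x0.
  by rewrite big_seq1 /vol expr0 mul1r.
have [s sP] := lreps_ex S MN.
exists [seq row_mx (x%:M : 'rV[K]_1) y | x <- s, y <- s'].
  exact: reps_row_mx.
move=> f [f0 fM] /=.
have fy x : step S (V := affine S n) N M (fun y => f (row_mx (x%:M : 'rV[K]_1) y)).
  split=> [y yN|y y' yM]; first by rewrite f0// ball_row_mx negb_and yN orbT.
  rewrite -[x in LHS]addr0 (row_mxD x 0 y y'); apply: fM.
  by rewrite ball_row_mx lball0.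
have -> : (fun x => integraln S (fun y => f (row_mx (x%:M : 'rV[K]_1) y))) =
    fun x => vol S n M * \sum_(r <- s') f (row_mx (x%:M : 'rV[K]_1) r).
  by apply/funext => x; rewrite IH.
rewrite (integral1_step (N := N) (M := M) _ sP).
  rewrite -mulr_sumr mulrA big_allpairs_dep; congr (_ * _).
  by rewrite /vol -rmorphM /= -exprD.
split=> [x xN|x x' xM].
  by rewrite big1 ?mulr0// => r _; rewrite f0// ball_row_mx negb_and xN.
congr (_ * _); apply: eq_bigr => r _.
rewrite -[r in LHS]addr0 (row_mxD x x' r 0); apply: fM.
by rewrite ball_row_mx aball0 andbT.
Qed.

Lemma aball_compact n k : compact [set x : affine S n | ball n k x].
Proof.
have := @rV_compact (pointed_top K) n (fun=> [set y : K | lball k y])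
  (fun=> @lball_compact R K S k).
by congr (@compact _ _); apply/seteqP; split=> x /ball_coordP.
Qed.

Lemma aball_nbhs n k (x : affine S n) : nbhs x [set y | ball n k (y - x)].
Proof.
exists (fun _ j => [set y : K | lball k (y - x 0 j)]) => [i j /=|y /= yx].
  by rewrite (ord1 i); apply: lball_nbhs.
by apply/ball_coordP => j; rewrite !mxE; apply: yx.
Qed.

Lemma affine_selfdual n : (0 < n)%N -> selfdual S (affine S n) n.
Proof.
move=> n0; split.
- exact: aball0.
- exact: aballD.
- exact: aballN.
- exact: aball_exhaust.
- by move=> k; apply: aball_proper.
- exact: normn_sphere.
- move=> x y z; rewrite /= /dotn -big_split; apply: eq_bigr => j _ /=.
  by rewrite mxE mulrDl.
- by move=> x y; apply: eq_bigr => j _; rewrite mulrC.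
- exact: dotn_chi1.
- exact: dotn_chi_neq1.
- exact: integraln_step.
- apply: test_step_topology.
  + exact: aball_exhaust.
  + exact: aball_nbhs.
  + exact: aball_compact.
  + exact: aballD.
  + exact: aballN.
Qed.

End Affine.

(** * Functionals on Lizorkin spaces and spectral kernels *)

Section SymmetricSums.
Variable A : zmodType.
Implicit Types (a : int -> A) (L : nat) (k : int).

(** Frequencies are integers and every test function has its frequencies between
    q^(-L) and q^L for some L, so sums over frequencies range over symmetric
    intervals. *)
Definition symsum L a : A := \sum_(i < (2 * L).+1) a (i%:Z - L%:Z).

Lemma symsumS L a : symsum L.+1 a = a (- L.+1%:Z) + symsum L a + a L.+1%:Z.
Proof.
rewrite /symsum (_ : (2 * L.+1).+1 = (2 * L).+3)%N; last by lia.
rewrite big_ord_recl big_ord_recr /= addrA; congr (a _ + _ + a _).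
- by rewrite sub0r.
- by apply: eq_bigr => i _; congr a; rewrite /bump /=; lia.
- by rewrite /bump /=; lia.
Qed.

Lemma symsum_widen L L' a : (L <= L')%N ->
  (forall k, (L < `|k|)%N -> a k = 0) -> symsum L' a = symsum L a.
Proof.
move=> LL' a0; rewrite -(subnKC LL'); elim: (L' - L)%N => [|n IH]; first by rewrite addn0.
by rewrite addnS symsumS IH !a0 ?addr0 ?add0r//; lia.
Qed.

Lemma symsum1 L k a : (`|k| <= L)%N -> (forall j, j != k -> a j = 0) ->
  symsum L a = a k.
Proof.
move=> kL a0; have kL' : (absz (k + L%:Z)%R < (2 * L).+1)%N by lia.
rewrite /symsum (bigD1 (Ordinal kL'))//= big1 => [|i].
  by rewrite addr0; congr a; lia.
by rewrite -val_eqE /= => /eqP ik; apply: a0; apply/eqP; lia.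
Qed.

Lemma eq_symsum L a b : (forall k, a k = b k) -> symsum L a = symsum L b.
Proof. by move=> ab; apply: eq_bigr. Qed.

End SymmetricSums.

Section Functionals.
Context (R : realType) (K : nonArchLocalFieldType) (S : local_field_data R K).
Variables (V : kspace R K) (d : nat).
Hypothesis sdV : @selfdual R K S V d.
Local Notation C := R[i].
Local Notation q := ((resq S)%:R : R).
Implicit Types (f g phi : V -> C) (N M m k : int) (x y : V).
Local Notation inball := (@inball R K S V).
Local Notation vol := (@vol R K S d).

Definition indic_ball m a x : C := (inball m (x - a))%:R.

Lemma indic_ball_step m a : exists N, step S N m (indic_ball m a).
Proof.
have [k ak] := ball_exhaust sdV a; exists (Num.max m k); split=> [x xN|x x' xm].
  rewrite /indic_ball; case: (boolP (inball m (x - a))) => // xa.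
  move: xN; rewrite -[x](subrK a) (ballD sdV)//.
    by apply: ball_le xa; lia.
  by apply: ball_le ak; lia.
by rewrite /indic_ball addrAC (ballDr sdV _ xm).
Qed.

Lemma indic_ball_test m a : test S (indic_ball m a).
Proof. by have [N IN] := indic_ball_step m a; exact: (test_stepT sdV IN). Qed.

Lemma kint_indic_ball m a : kint (indic_ball m a) = vol m.
Proof.
rewrite -(kint_shift sdV a (indic_ball_test m a)).
have E : step S m m (fun x => indic_ball m a (a + x)).
  split=> [x /negPf xm|x x' xm]; rewrite /indic_ball !(addrC a) !addrK ?xm//.
  by rewrite (ballDr sdV _ xm).
rewrite (kint_step sdV (lexx m) E (reps_refl sdV m)) big_seq1 addr0.
by rewrite /indic_ball subrr (ball0 sdV) mulr1.
Qed.

(** Testing against the difference of the indicators of two translates of a small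
    ball shows that f takes the same value at x and at a point outside its
    support. *)
Lemma test_weak_eq0 f : test S f ->
  (forall phi, lizorkin S phi -> kint (fun x => f x * phi x) = 0) ->
  forall x, f x = 0.
Proof.
move=> tf f0 x; have [L fL] := (step_testL sdV f).2 tf.
have [z zL] := ball_proper sdV L; pose m := - L%:Z.
have fI a : kint (fun y => f y * indic_ball m a y) = f a * vol m.
  rewrite -(kint_indic_ball m a) -(kint_scale sdV _ (indic_ball_test m a)).
  apply: kint_ext => y; rewrite /indic_ball.
  have [ya|_] := boolP (inball m (y - a)); last by rewrite !mulr0.
  by rewrite -(fL.2 a _ ya) addrC subrK.
have tI a : test S (fun y => f y * indic_ball m a y).
  have -> : (fun y => f y * indic_ball m a y) = (fun y => f a * indic_ball m a y).
    apply/funext => y; rewrite /indic_ball.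
    have [ya|_] := boolP (inball m (y - a)); last by rewrite !mulr0.
    by rewrite -(fL.2 a _ ya) addrC subrK.
  exact: (test_scale sdV) (indic_ball_test m a).
pose phi := lin 1 (indic_ball m x) (-1) (indic_ball m z).
have phiP : lizorkin S phi.
  split; first by apply: (test_lin sdV) => //; apply: indic_ball_test.
  by rewrite (kint_lin sdV) ?kint_indic_ball ?mul1r ?mulN1r ?subrr//; apply: indic_ball_test.
have := f0 _ phiP.
rewrite (_ : (fun y => _) = lin 1 (fun y => f y * indic_ball m x y) (-1)
  (fun y => f y * indic_ball m z y)); last by apply/funext => y; rewrite /phi /lin; ring.
rewrite (kint_lin sdV)// !fI (fL.1 z zL) mul0r mulr0 addr0 mul1r => /eqP.
by rewrite mulf_eq0 (negPf (vol_neq0 _ _ _)) orbF => /eqP.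
Qed.

Lemma lizorkin_lin a f b g : lizorkin S f -> lizorkin S g ->
  lizorkin S (lin a f b g).
Proof.
move=> [tf f0] [tg g0]; split; first by apply: (test_lin sdV).
by rewrite (kint_lin sdV)// f0 g0 !mulr0 addr0.
Qed.

Definition linear_on_lizorkin (T : (V -> C) -> C) : Prop :=
  forall a f b g, lizorkin S f -> lizorkin S g ->
    T (lin a f b g) = a * T f + b * T g.

Lemma lizorkin0 : lizorkin S (fun _ : V => 0).
Proof. by split; [exact: test0 sdV|exact: kint0 sdV]. Qed.

Section LinearFunctional.
Variables (T : (V -> C) -> C).
Hypothesis linT : linear_on_lizorkin T.

Lemma functional_scale c f : lizorkin S f -> T (fun x => c * f x) = c * T f.
Proof.
move=> fP; rewrite (_ : (fun _ => _) = lin c f 0 f) ?linT ?mul0r ?addr0//.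
by apply/funext => x; rewrite /lin mul0r addr0.
Qed.

Lemma functional_sum (I : eqType) (s : seq I) (c : I -> C) (g : I -> V -> C) :
  (forall i, i \in s -> lizorkin S (g i)) ->
  T (fun x => \sum_(i <- s) c i * g i x) = \sum_(i <- s) c i * T (g i).
Proof.
by move=> gP; have [] := linear_comb lizorkin0 lizorkin_lin linT c gP.
Qed.

Lemma functional_symsum L (g : int -> V -> C) : (forall k, lizorkin S (g k)) ->
  T (fun x => symsum L (g^~ x)) = symsum L (fun k => T (g k)).
Proof.
move=> gP; rewrite /symsum; under [RHS]eq_bigr do rewrite -[T _]mul1r.
rewrite -functional_sum => [|i _]; last exact: gP.
congr T; apply/funext => x.
by apply: eq_bigr => i _; rewrite mul1r.
Qed.

(** The topology is the finest locally convex one: each step is spanned by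
    finitely many indicators of balls, so T is bounded on its sup-norm unit ball.
    Neighbourhoods are traces of sets of test functions, hence T is first
    extended to all test functions by subtracting a multiple of a fixed function
    of integral 1. *)
Lemma linear_lizorkin_dual : lizorkin_dual S T.
Proof.
split=> [a b f g lf lg|eps e0]; first exact: linT.
pose u := indic_ball 0 0.
have tu : test S u by apply: indic_ball_test.
have u1 : kint u = 1 by rewrite kint_indic_ball /vol expr0z expr1n.
pose T' f := T (lin 1 f (- kint f) u).
have lizT f : test S f -> lizorkin S (lin 1 f (- kint f) u).
  move=> tf; split; first by apply: (test_lin sdV).
  by rewrite (kint_lin sdV)// u1 mulr1 mul1r subrr.
have linT' a f b g : test S f -> test S g -> T' (lin a f b g) = a * T' f + b * T' g.
  move=> tf tg; rewrite -linT; [|exact: lizT..]; congr T; apply/funext => x.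
  rewrite (kint_lin sdV)// /lin; ring.
exists [set f | test S f /\ `|T' f| < eps%:C]; last first.
  move=> f [[tf Tf] [_ f0]] /=; rewrite (_ : f = lin 1 f (- kint f) u)//.
  by apply/funext => x; rewrite /lin f0 mul1r oppr0 mul0r addr0.
exists [set f | test S f /\ `|T' f| < eps%:C]; split=> //; last by move=> f [].
  move=> a b f g ab [tf Tf] [tg Tg]; split; first by apply: (test_lin sdV).
  rewrite linT'//; apply: le_lt_trans (ler_normD _ _) _; rewrite !normrM.
  have e0' : 0 < eps%:C by rewrite ltcR.
  have [a0|a0] := eqVneq a 0.
    rewrite a0 normr0 mul0r add0r; move: ab; rewrite a0 normr0 add0r => b1.
    by apply: le_lt_trans Tg; rewrite ler_piMl.
  apply: (@lt_le_trans _ _ (`|a| * eps%:C + `|b| * eps%:C)).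
    by apply: ltr_leD; rewrite ?ltr_pM2l ?normr_gt0// ler_wpM2l// ltW.
  by rewrite -mulrDl ler_piMl// ltW.
move=> N l.
(* A support ball smaller than the period is enlarged to it. *)
pose N' := Num.max N (- l).
have lN : - l <= N' by rewrite /N'; lia.
have [s sP] := reps_ex sdV lN.
pose B := \sum_(r <- s) `|T' (indic_ball (- l) r)|.
have B0 : 0 <= B by apply: sumr_ge0.
have [b bB] : exists b : R, B = b%:C.
  by exists (complex.Re B); rewrite RRe_real// ger0_real.
have b0 : 0 <= b by rewrite -lecR -bB.
(* The sum b may be 0, so it is increased by 1 before dividing. *)
exists (eps / (b + 1)) => [|f [f0 fl] fs]; first by rewrite divr_gt0// ltr_wpDl.
have fP : step S N' (- l) f.
  split=> [x xN|x x' xl]; last exact: fl.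
  apply: f0; rewrite ltNge; apply: contra xN; apply: ball_le; rewrite /N'; lia.
split; first exact: (test_stepT sdV fP).
have tI r := indic_ball_test (- l) r.
have fE : f = fun x => \sum_(r <- s) f r * indic_ball (- l) r x.
  apply/funext => x; have [xN|xN] := boolP (inball N' x); last first.
    rewrite fP.1// big_seq big1// => r /(allP sP.1) rN; rewrite /indic_ball.
    have [xr|_] := boolP (inball (- l) (x - r)); last by rewrite mulr0.
    case/negP: xN; rewrite -[x](subrK r) (ballD sdV)//.
    exact: ball_le lN xr.
  transitivity (f x * \sum_(r <- s) indic_ball (- l) r x).
    by rewrite -count_sum sP.2// mulr1.
  rewrite mulr_sumr; apply: eq_bigr => r _; rewrite /indic_ball.
  have [xr|_] := boolP (inball (- l) (x - r)); last by rewrite !mulr0.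
  by rewrite -(fP.2 r _ xr) addrC subrK.
have TE : T' f = \sum_(r <- s) f r * T' (indic_ball (- l) r).
  rewrite [in LHS]fE.
  by have [] := linear_comb (test0 sdV) (test_lin sdV) linT' f (fun r (_ : r \in s) => tI r).
rewrite TE; apply: le_lt_trans (ler_norm_sum _ _ _) _.
apply: (@le_lt_trans _ _ ((eps / (b + 1))%:C * B)).
  rewrite mulr_sumr; apply: ler_sum => r _; rewrite normrM ler_wpM2r//.
  exact/ltW/fs.
rewrite bB -rmorphM ltcR mulrAC -mulrA gtr_pMr// ltr_pdivrMr ?ltr_wpDl//.
by rewrite mul1r ltrDl.
Qed.

End LinearFunctional.

(** The inverse Fourier transform of the indicator of the sphere of radius q^k:
    convolution with it is the projection to the frequency q^k. *)
Definition sphere_kernel k : V -> C :=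
  lin (vol (- k))^-1 (indic_ball (- k) 0) (- (vol (1 - k))^-1) (indic_ball (1 - k) 0).

Lemma kint_sphere_kernel k g : test S g ->
  kint (fun x => sphere_kernel k x * g x) = proj S d k g 0.
Proof.
move=> tg.
have tI m : test S (fun x => indic_ball m 0 x * g x).
  by apply: (test_mul sdV) => //; apply: indic_ball_test.
have -> : (fun x => sphere_kernel k x * g x) =
    lin (vol (- k))^-1 (fun x => indic_ball (- k) 0 x * g x)
      (- (vol (1 - k))^-1) (fun x => indic_ball (1 - k) 0 x * g x).
  by apply/funext => x; rewrite /sphere_kernel /lin; ring.
rewrite (kint_lin sdV)// /proj /lin mul1r mulN1r mulNr /avg.
by congr (_ * _ - _ * _); apply: kint_ext => x; rewrite /indic_ball subr0 add0r.
Qed.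

Lemma sphere_kernel_spectral k : spectral S d k (sphere_kernel k).
Proof.
have tk : test S (sphere_kernel k) by apply: (test_lin sdV) => //; apply: indic_ball_test.
have pk : periodic S (- k) (sphere_kernel k).
  move=> x x' xk; rewrite /sphere_kernel /lin /indic_ball !subr0 (ballDr sdV _ xk).
  have xk' : inball (1 - k) x' by apply: ball_le xk; lia.
  by rewrite (ballDr sdV _ xk').
split=> // x; apply: (avg_eq0 sdV (M := - k)).
  split=> // y yk; rewrite /sphere_kernel /lin /indic_ball !subr0 (negPf yk) mulr0 addr0.
  have /negPf-> : ~~ inball (- k) y by apply: contra yk; apply: ball_le; lia.
  by rewrite mulr0.
rewrite (kint_lin sdV); [|exact: indic_ball_test..]; rewrite !kint_indic_ball.
by rewrite mulNr !mulVf ?subrr// vol_neq0.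
Qed.

Lemma sphere_kernel0_neq0 k : (0 < d)%N -> sphere_kernel k 0 != 0.
Proof.
move=> d0; rewrite /sphere_kernel /lin /indic_ball subr0 !(ball0 sdV) !mulr1.
rewrite subr_eq0 (inj_eq invr_inj); apply/negP => /eqP[] /eqP.
have q1 := resq_gt1 S.
rewrite (eqrXn2 d0) ?exprz_ge0 ?ler0n//.
have q0 : 0 < q by apply: lt_trans q1.
have qn1 : q != 1 by rewrite gt_eqF.
by rewrite (inj_eq (ieexprIz q0 qn1)) => /eqP; lia.
Qed.

End Functionals.

(** * Radial spectral functions *)

Section Radial.
Context (R : realType) (K : nonArchLocalFieldType) (S : local_field_data R K).
Local Notation C := R[i].
Local Notation q := ((resq S)%:R : R).
Local Notation ab := (absv S).
Local Notation L1 := (line S).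
Local Notation sd1 := (line_selfdual S).
Local Notation inball := (@inball R K S L1).
Local Notation kern := (@sphere_kernel R K S L1 1).
Local Notation spectral1 := (@spectral R K S L1 1).
Implicit Types (g h : K -> C) (x y t omega : K) (j k : int).

Lemma ball_unitM omega k x : ab omega = 1 -> inball k (omega * x) = inball k x.
Proof. by move=> o1; rewrite !lballE absM o1 mul1r. Qed.

Lemma reps_unitM omega N M s : ab omega = 1 -> coset_reps S (V := L1) N M s ->
  coset_reps S (V := L1) N M [seq omega * r | r <- s].
Proof.
move=> o1 [sN s1]; have o0 : omega != 0.
  by apply/eqP => o0; move: o1; rewrite o0 abs0 => /esym/eqP; rewrite oner_eq0.
split=> [|x xN].
  by rewrite all_map; apply/allP => r /(allP sN) /= rN; rewrite ball_unitM.
have oV1 : ab omega^-1 = 1 by rewrite absV o1 invr1.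
rewrite count_map -(s1 (omega^-1 * x)); last by rewrite ball_unitM.
apply: eq_count => r /=; rewrite -(ball_unitM M _ oV1) mulrBr.
by rewrite mulKf.
Qed.

Lemma step_unitM omega N M g : ab omega = 1 -> step S (V := L1) N M g ->
  step S (V := L1) N M (fun t => g (omega * t)).
Proof.
move=> o1 [g0 gM]; split=> [x xN|x x' xM]; first by rewrite g0 ?ball_unitM.
by rewrite mulrDr gM ?ball_unitM.
Qed.

Lemma test_unitM omega g : ab omega = 1 -> test S (V := L1) g ->
  test S (V := L1) (fun t => g (omega * t)).
Proof.
move=> o1 /(testP sd1)[N [M gNM]]; apply/(testP sd1); exists N, M.
exact: step_unitM.
Qed.

Lemma kint_unitM omega g : ab omega = 1 -> test S (V := L1) g ->
  kint (k := L1) (fun t => g (omega * t)) = kint (k := L1) g.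
Proof.
move=> o1 /(step_testL sd1)[L gL]; have nn : - L%:Z <= L%:Z by lia.
have [s sP] := reps_ex sd1 nn.
rewrite (kint_step sd1 nn (step_unitM o1 gL) sP) (kint_step sd1 nn gL sP).
congr (_ * _); rewrite -(reps_sum sd1 gL.2 (reps_unitM o1 sP) sP) big_map.
by [].
Qed.

Lemma spectral_unitM omega k g : ab omega = 1 -> spectral1 k g ->
  spectral1 k (fun t => g (omega * t)).
Proof.
move=> o1 [tg gk g0]; split; first exact: test_unitM.
  by move=> x x' xk; rewrite mulrDr gk ?ball_unitM.
move=> x; rewrite -[RHS](g0 (omega * x)) /avg; congr (_ * _).
have [L gL] := (step_testL sd1 g).2 tg.
have gL' : periodic S (V := L1) (- L%:Z - `|k|) g by apply: periodic_le gL.2; lia.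
have tc : test S (V := L1) (fun y => (inball (1 - k) y)%:R * g (omega * x + y)).
  have Lk : - L%:Z - `|k| <= 1 - k by lia.
  exact: (test_stepT sd1 (cut_step sd1 _ Lk gL')).
rewrite -(kint_unitM o1 tc); apply: kint_ext => y.
by rewrite ball_unitM// mulrDr.
Qed.

(** All points of the ball of radius q^m around x have the absolute value of x, so
    a radial function is constant there. *)
Lemma avg_radial m g x : (forall omega, ab omega = 1 -> g (omega * x) = g x) ->
  ~~ inball m x -> avg S 1 (V := L1) m g x = g x.
Proof.
move=> gr xm; have x0 : x != 0 by apply: contra xm => /eqP->; apply: lball0.
have E : (fun y => (inball m y)%:R * g (x + y)) = fun y => g x * indic_ball S (V := L1) m 0 y.
  apply/funext => y; rewrite /indic_ball subr0.
  have [ym|_] := boolP (inball m y); last by rewrite mul0r mulr0.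
  rewrite mulr1 mul1r -[x + y](divfK x0) gr// absM absV.
  suff -> : ab (x + y) = ab x by rewrite mulfV// abs_eq0.
  move: xm ym; rewrite !lballE -ltNge => xm ym.
  have yx := le_lt_trans ym xm.
  apply/eqP; rewrite eq_le; apply/andP; split.
    by apply: le_trans (absvalD (absvP S) x y) _; rewrite ge_max lexx (ltW yx).
  have := absvalD (absvP S) (x + y) (- y); rewrite addrK absN le_max.
  by rewrite [ab x <= ab y]leNgt yx orbF.
rewrite /avg E (kint_scale sd1) ?(kint_indic_ball sd1); last exact: (indic_ball_test sd1).
by rewrite mulrCA mulVf ?mulr1// vol_neq0.
Qed.

(** Three regions. On the ball of radius q^(-k), h is constant, hence 0. Outside
    the ball of radius q^(1 - k), h equals its own means, which vanish. On the
    sphere between them h is a constant, and it is 0 because the integral of h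
    is. *)
Lemma spectral_radial_eq0 k h : spectral1 k h ->
  (forall x omega, ab omega = 1 -> h (omega * x) = h x) -> h 0 = 0 ->
  forall x, h x = 0.
Proof.
move=> hs hr h0; have [th hk ha] := hs.
(* The value of h on the sphere of radius q^(1 - k) is h p. *)
have [p pk] := abs_scalar S (1 - k).
have pn0 : p != 0.
  by rewrite -(abs_eq0 S) pk expfz_neq0// pnatr_eq0 -lt0n -(ltr_nat R) (lt_trans _ (resq_gt1 S)).
have h1 x : inball (- k) x -> h x = 0 by move=> xk; rewrite -[x]add0r hk.
have h2 x : ~~ inball (1 - k) x -> h x = 0.
  by move=> xk; rewrite -(avg_radial _ xk) ?ha// => o; apply: hr.
have hE x : h x = lin (h p) (indic_ball S (V := L1) (1 - k) 0)
    (- h p) (indic_ball S (V := L1) (- k) 0) x.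
  rewrite /lin /indic_ball subr0.
  have [xk|xk] := boolP (inball (- k) x).
    have -> : inball (1 - k) x by apply: ball_le xk; lia.
    by rewrite h1//= !mulr1 subrr.
  have [xk'|xk'] := boolP (inball (1 - k) x); last by rewrite h2// !mulr0 addr0.
  rewrite mulr1 mulr0 addr0.
  have ax : ab x = q ^ (1 - k).
    by apply: abs_sphere => //; rewrite (_ : 1 - k - 1 = - k) //; ring.
  rewrite -[x](divfK pn0) hr// absM absV ax pk mulfV//.
  by rewrite -pk abs_eq0.
have := spectral_kint0 sd1 hs; rewrite (funext hE) (kint_lin sd1); [|exact: (indic_ball_test sd1)..].
rewrite !(kint_indic_ball sd1) mulNr -mulrBr => /eqP; rewrite mulf_eq0.
have /negPf -> : vol S 1 (1 - k) - vol S 1 (- k) != 0.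
  have := sphere_kernel0_neq0 sd1 k (ltnSn 0).
  rewrite /sphere_kernel /lin /indic_ball subr0 !lball0 !mulr1 subr_eq0 (inj_eq invr_inj).
  by rewrite subr_eq0 eq_sym.
by rewrite orbF => /eqP hp x; rewrite /lin hp oppr0 !mul0r addr0.
Qed.

Lemma spectral_radial k g : spectral1 k g ->
  (forall x omega, ab omega = 1 -> g (omega * x) = g x) ->
  g = fun x => g 0 / kern k 0 * kern k x.
Proof.
move=> gs gr; pose h : K -> C := lin (V := L1) 1 g (- (g 0 / kern k 0)) (kern k).
have kn0 := sphere_kernel0_neq0 sd1 k (ltnSn 0).
have hs : spectral1 k h by apply: (spectral_lin sd1) => //; apply: (sphere_kernel_spectral sd1).
apply/funext => x; apply/eqP; rewrite -subr_eq0 -mulNr -[g x]mul1r; apply/eqP.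
apply: (spectral_radial_eq0 hs) => [y o o1|].
  by rewrite /h /lin gr// /sphere_kernel /lin /indic_ball !subr0 !ball_unitM.
by rewrite /h /lin mul1r mulNr divfK// subrr.
Qed.

Definition unit_mean (s : seq K) g t : C :=
  \sum_(r <- s) (size s)%:R^-1 * g (r * t).

(** The units among representatives of the integers modulo a small ball represent
    the quotient of the unit group by a small subgroup. Multiplication by a unit
    permutes the classes, and on the support of g the subgroup moves points by
    periods of g. *)
Lemma unit_mean_radial k g : spectral1 k g -> exists s : seq K,
  [/\ (0 < size s)%N, forall r, r \in s -> ab r = 1, spectral1 k (unit_mean s g) &
    forall x omega, ab omega = 1 -> unit_mean s g (omega * x) = unit_mean s g x].
Proof.
move=> gs; have [tg gk g0] := gs; have [L gL] := (step_testL sd1 g).2 tg.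
(* For t in the support of g, of radius q^L, changing r by at most q^(-m) moves
   r t by at most q^(-k), a period of g. Since m > 0, units remain units. *)
pose m := (L + `|k|).+1; have m0 : - m%:Z <= 0 by lia.
have [s sP] := reps_ex sd1 m0; exists [seq r <- s | ab r == 1].
have unitD (u u' : K) : inball (- m%:Z) u' -> (ab (u + u') == 1) = (ab u == 1).
  move=> u'm; suff H (v v' : K) : inball (- m%:Z) v' -> ab v = 1 -> ab (v + v') = 1.
    apply/eqP/eqP => [uu'|]; last exact: H.
    by rewrite -[u](addrK u'); apply: H; rewrite ?lballN.
  move=> v'm v1; have := @abs_sphere _ _ S 0 (v + v'); rewrite expr0z; apply.
    by apply: lballD; [rewrite lballE v1 expr0z|apply: ball_le v'm].
  have v'1 : inball (0 - 1) v' by apply: ball_le v'm; lia.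
  rewrite (ballDr sd1 _ v'1) lballE v1 sub0r exprN1 -ltNge invf_lt1 ?resq_gt1//.
  exact: lt_trans (resq_gt1 S).
have sU r : r \in [seq r <- s | ab r == 1] -> ab r = 1.
  by rewrite mem_filter => /andP[/eqP].
split=> //.
- have /hasP[r rs r1] : has (fun r => inball (- m%:Z) (1 - r)) s.
    by rewrite has_count sP.2// lballE abs1 expr0z.
  rewrite size_filter -has_count; apply/hasP; exists r => //=.
  by rewrite -(unitD r (1 - r))// addrC subrK abs1.
- have [] // := linear_comb (P := spectral1 k) (T := fun=> 0) _ _ _
    (fun=> (size [seq r <- s | ab r == 1])%:R^-1)
    (fun r (rs : r \in [seq r <- s | ab r == 1]) => spectral_unitM (sU r rs) gs).
  + rewrite (_ : (fun=> 0) = lin (V := L1) 0 g 0 g); first exact: (spectral_lin sd1).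
    by apply/funext => t; rewrite /lin !mul0r addr0.
  + by move=> a f b h; apply: (spectral_lin sd1).
  + by move=> a f b h _ _; rewrite !mulr0 addr0.
- move=> x o o1; rewrite /unit_mean -!mulr_sumr; congr (_ * _).
  rewrite !big_filter big_mkcond [RHS]big_mkcond /=.
  pose h (u : K) : C := if ab u == 1 then g (u * x) else 0.
  have hp : periodic S (V := L1) (- m%:Z) h.
    move=> u u' u'm; rewrite /h unitD//; case: eqP => // u1.
    have [xL|xL] := boolP (inball L x); last first.
      have au : ab (u + u') = 1 by apply/eqP; rewrite unitD// u1.
      by rewrite !gL.1// ball_unitM.
    rewrite mulrDl gk// lballE absM (_ : - k = - m%:Z + (m%:Z - k)); last by ring.
    rewrite expfzDr; last first.
      by rewrite pnatr_eq0 -lt0n -(ltr_nat R) (lt_trans _ (resq_gt1 S)).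
    apply: ler_pM => //; try exact: (absval_ge0 (absvP S)).
    by have : inball (m%:Z - k) x by apply: ball_le xL; lia.
  rewrite -[RHS](reps_sum sd1 hp (reps_unitM o1 sP) sP) big_map.
  apply: eq_bigr => r _; rewrite /h absM o1 mul1r; case: ifP => // _.
  by rewrite mulrA (mulrC r).
Qed.

End Radial.

(** * Radial solutions *)

Section Solution.
Context (R : realType) (K : nonArchLocalFieldType) (S : local_field_data R K).
Variables (n : nat) (alpha : R) (F : (K -> R[i]) -> ('rV[K]_n -> R[i]) -> R[i]).
Hypotheses (n_gt0 : (0 < n)%N) (alpha_gt0 : 0 < alpha).
Hypotheses (distF : vdistribution S F) (solF : generalized_solution S alpha F).
Hypothesis radF : radial S F.
Local Notation C := R[i].
Local Notation q := ((resq S)%:R : R).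
Local Notation ab := (absv S).
Local Notation L1 := (line S).
Local Notation An := (affine S n).
Local Notation sd1 := (line_selfdual S).
Let sdn : selfdual S An n := affine_selfdual S n_gt0.
Local Notation kern := (@sphere_kernel R K S L1 1).
Local Notation spectral1 := (@spectral R K S L1 1).
Local Notation spectraln := (@spectral R K S An n).
Local Notation projn := (@proj R K S An n).
Local Notation liz1 := (@lizorkin R K S L1).
Local Notation lizn := (@lizorkin R K S An).
Implicit Types (phi g h : K -> C) (psi : 'rV[K]_n -> C) (t : K) (j k : int) (L : nat).

Lemma linear_fst psi : lizn psi -> linear_on_lizorkin S (V := L1) (F^~ psi).
Proof. by move=> p2 a f b g fP gP; have [_ + _] := distF; apply. Qed.

Lemma linear_snd phi : liz1 phi -> linear_on_lizorkin S (V := An) (F phi).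
Proof.
by move=> p1 a f b g fP gP; have [/(_ _ p1)[+ _] _ _] := distF; apply.
Qed.

Lemma kern_lizorkin k : liz1 (kern k).
Proof. exact: (spectral_lizorkin sd1 (sphere_kernel_spectral sd1 k)). Qed.

Lemma kern0_neq0 k : kern k 0 != 0.
Proof. exact: sphere_kernel0_neq0 sd1 k (ltnSn 0). Qed.

Lemma proj_lizorkin k psi : lizn psi -> lizn (projn k psi).
Proof. by move=> [t2 _]; apply: (spectral_lizorkin sdn (proj_spectral sdn k t2)). Qed.

Let q_gt1 := resq_gt1 S.

(** The two sides of the equation are different multiples of F phi psi, since
    j != k and alpha > 0. *)
Lemma spectral_orthogonal j k phi psi : spectral1 j phi -> spectraln k psi ->
  j != k -> F phi psi = 0.
Proof.
move=> s1 s2 jk.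
have l1 := spectral_lizorkin sd1 s1; have l2 := spectral_lizorkin sdn s2.
have := solF l1 l2; rewrite (spectral_fracD sd1 _ s1) (spectral_fracD sdn _ s2).
rewrite (functional_scale (linear_fst l2) _ l1) (functional_scale (linear_snd l1) _ l2).
move/eqP; rewrite -subr_eq0 -mulrBl mulf_eq0 => /orP[|/eqP//].
rewrite subr_eq0 => /eqP[] /eqP; rewrite -[_ == _]/(_ == _ :> R).
have q0 : 0 < q by apply: lt_trans q_gt1.
have qn1 : q != 1 by rewrite gt_eqF.
move/eqP/(congr1 (fun z => z `^ alpha^-1)); rewrite -!powRrM mulfV ?gt_eqF//.
rewrite !powRr1 ?exprz_ge0 ?(ltW q0)// => /eqP.
by rewrite (inj_eq (ieexprIz q0 qn1)) (negPf jk).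
Qed.

Lemma lizorkin_symsum L psi : step S (V := An) L (- L%:Z) psi -> lizn psi ->
  psi = fun x => symsum L (fun k => projn k psi x).
Proof. by move=> pL [_ p0]; apply: (proj_sum sdn). Qed.

(** All components of psi except the one of frequency q^j are orthogonal to
    kern j. *)
Lemma kern_proj L j psi : step S (V := An) L (- L%:Z) psi -> lizn psi ->
  F (kern j) psi = if (`|j| <= L)%N then F (kern j) (projn j psi) else 0.
Proof.
move=> pL lp; rewrite [in LHS](lizorkin_symsum pL lp).
rewrite (functional_symsum sdn (linear_snd (kern_lizorkin j))); last first.
  by move=> k; apply: proj_lizorkin.
have F0 k : k != j -> F (kern j) (projn k psi) = 0.
  move=> kj; have jk : j != k by rewrite eq_sym.
  exact: spectral_orthogonal (sphere_kernel_spectral sd1 j) (proj_spectral sdn k lp.1) jk.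
case: leqP => jL; first exact: symsum1.
rewrite /symsum big1// => i _; apply: F0; apply/eqP.
have := ltn_ord i; lia.
Qed.

(** By radiality, F takes the same value at phi and at its mean over units, which
    is a multiple of the kernel; evaluation at 0 determines the multiple. *)
Lemma spectral_value k phi psi : spectral1 k phi -> lizn psi ->
  F phi psi = phi 0 / kern k 0 * F (kern k) psi.
Proof.
move=> s1 l2; have [s [s0 sU sm sr]] := unit_mean_radial s1.
have sum_mean (z : C) : \sum_(r <- s) (size s)%:R^-1 * z = z.
  rewrite -mulr_suml big_const_seq count_predT iter_addr_0.
  by rewrite -[_^-1 *+ _]mulr_natl mulfV ?mul1r// pnatr_eq0 -lt0n.
have -> : F phi psi = F (unit_mean s phi) psi.
  rewrite (functional_sum sd1 (linear_fst l2) _ (g := fun r t => phi (r * t))).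
    rewrite -[LHS]sum_mean big_seq [RHS]big_seq; apply: eq_bigr => r /sU r1.
    by rewrite radF//; apply: (spectral_lizorkin sd1 s1).
  by move=> r /sU r1; apply: (spectral_lizorkin sd1 (spectral_unitM r1 s1)).
rewrite [in LHS](spectral_radial sm sr) (functional_scale (linear_fst l2) _ (kern_lizorkin k)).
congr (_ / _ * _); rewrite /unit_mean -[RHS]sum_mean; apply: eq_bigr => r _.
by rewrite mulr0.
Qed.

(** The component of phi of frequency q^k is the convolution of phi with the even
    function kern k, so its value at 0 is the integral of kern k * phi. *)
Lemma F_expansion L phi psi : step S (V := L1) L (- L%:Z) phi ->
  liz1 phi -> lizn psi ->
  F phi psi = symsum L (fun k =>
    kint (k := L1) (fun t => kern k t * phi t) / kern k 0 * F (kern k) psi).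
Proof.
move=> pL [t1 p0] l2.
have sp k := proj_spectral sd1 k t1.
rewrite [in LHS](proj_sum sd1 pL p0).
rewrite (functional_symsum sd1 (linear_fst l2) L
  (g := fun k => proj S 1 (V := L1) k phi)); last first.
  by move=> k; apply: (spectral_lizorkin sd1 (sp k)).
apply: eq_symsum => k; rewrite (spectral_value (sp k) l2).
by rewrite (kint_sphere_kernel sd1 k t1).
Qed.

(** Bounds the frequencies of a Lizorkin function; the default 0 is never taken on
    test functions. *)
Definition level psi : nat :=
  if pselect (exists L : nat, step S (V := An) L (- L%:Z) psi) is left e
  then projT1 (cid e) else 0.

Lemma levelP psi : lizn psi -> step S (V := An) (level psi) (- (level psi)%:Z) psi.
Proof.
move=> [t2 _]; rewrite /level; case: pselect => [e|[]]; first exact: (projT2 (cid e)).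
exact/(step_testL sdn).
Qed.

Definition solution_density t psi : C :=
  symsum (level psi) (fun k => kern k t / kern k 0 * F (kern k) psi).

Lemma solution_density_widen L t psi : lizn psi -> (level psi <= L)%N ->
  solution_density t psi = symsum L (fun k => kern k t / kern k 0 * F (kern k) psi).
Proof.
move=> l2 pL; symmetry; apply: symsum_widen => // k kL.
by rewrite (kern_proj k (levelP l2) l2) leqNgt kL mulr0.
Qed.

Lemma solution_density_linear t : linear_on_lizorkin S (V := An) (solution_density t).
Proof.
move=> a f b g lf lg; have lfg := lizorkin_lin sdn a b lf lg.
pose L := (level f + level g + level (lin a f b g))%N.
rewrite !(@solution_density_widen L) //; try by rewrite /L; lia.
rewrite /symsum !mulr_sumr -big_split; apply: eq_bigr => i _ /=.
rewrite (linear_snd (kern_lizorkin _) _ _ lf lg); ring.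
Qed.

Lemma solution_densityE psi : solution_density^~ psi = fun t =>
  \sum_(i < (2 * level psi).+1) F (kern (i%:Z - (level psi)%:Z)) psi /
    kern (i%:Z - (level psi)%:Z) 0 * kern (i%:Z - (level psi)%:Z) t.
Proof. by apply/funext => t; apply: eq_bigr => i _; ring. Qed.

Lemma kern_test k : test S (V := L1) (kern k).
Proof. by case: (kern_lizorkin k). Qed.

Lemma solution_density_test psi : test S (V := L1) (solution_density^~ psi).
Proof.
rewrite solution_densityE.
by have [] := kint_sum sd1 (s := index_enum 'I_(2 * level psi).+1)
  (fun i => F (kern (i%:Z - (level psi)%:Z)) psi / kern (i%:Z - (level psi)%:Z) 0)
  (fun i _ => kern_test (i%:Z - (level psi)%:Z)).
Qed.

Lemma solution_density_given_by : given_by S F solution_density.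
Proof.
split=> [t|psi _|phi psi l1 l2].
- exact: (linear_lizorkin_dual sdn (@solution_density_linear t)).
- exact: solution_density_test.
have [N pN] := (step_testL sd1 phi).2 l1.1.
pose L := (N + level psi)%N.
have pL : step S (V := L1) L (- L%:Z) phi by apply: step_le pN; rewrite /L; lia.
rewrite (F_expansion pL l1 l2).
pose e (i : 'I_(2 * L).+1) := i%:Z - L%:Z.
have -> : (fun t => solution_density t psi * phi t) = fun t =>
    \sum_(i <- index_enum 'I_(2 * L).+1)
      F (kern (e i)) psi / kern (e i) 0 * (kern (e i) t * phi t).
  apply/funext => t; rewrite (@solution_density_widen L)//; last by rewrite /L; lia.
  by rewrite mulr_suml; apply: eq_bigr => i _; rewrite /e; ring.
have [|_ E] := kint_sum sd1 (s := index_enum 'I_(2 * L).+1)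
    (fun i => F (kern (e i)) psi / kern (e i) 0) (g := fun i t => kern (e i) t * phi t).
  by move=> i _; apply: (test_mul sd1); [exact: kern_test|case: l1].
by rewrite [RHS]E; apply: eq_bigr => i _; rewrite /e; ring.
Qed.

(** Two representing functions differ by a test function of t that annihilates all
    functions of integral 0. *)
Lemma given_by_unique f psi t : given_by S F f -> lizn psi ->
  f t psi = solution_density t psi.
Proof.
move=> [_ ft fF] l2; have [_ dt dF] := solution_density_given_by.
pose h : K -> C := lin (V := L1) 1 (f^~ psi) (-1) (solution_density^~ psi).
have th : test S (V := L1) h.
  by apply: (test_lin sd1); [apply: ft|apply: dt].
suff h0 : h t = 0 by apply/eqP; rewrite -subr_eq0 -mulN1r -[f t psi]mul1r -[X in X == 0]/(h t) h0.
apply: (test_weak_eq0 sd1 th) => phi l1.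
have -> : (fun x => h x * phi x) = lin (V := L1) 1 (fun x => f x psi * phi x) (-1)
    (fun x => solution_density x psi * phi x).
  by apply/funext => x; rewrite /h /lin; ring.
have t1 : test S (V := L1) phi by case: l1.
rewrite (kint_lin sd1); [|by apply: (test_mul sd1) => //; apply: ft|
  by apply: (test_mul sd1) => //; apply: dt].
have E1 := fF _ _ l1 l2; have E2 := dF _ _ l1 l2.
by rewrite /= -E1 -E2 mul1r mulN1r subrr.
Qed.

Lemma solution_density_proj k t psi : lizn psi ->
  solution_density t (projn k psi) = kern k t / kern k 0 * F (kern k) psi.
Proof.
move=> l2; have lp := proj_lizorkin k l2.
pose L := (level psi + level (projn k psi) + `|k|)%N.
rewrite (@solution_density_widen L)//; last by rewrite /L; lia.
rewrite (@symsum1 _ L k); [|by rewrite /L; lia|].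
  have pL : step S (V := An) L (- L%:Z) psi.
    by apply: step_le (levelP l2); rewrite /L; lia.
  rewrite (kern_proj k pL l2) (_ : (`|k| <= L)%N) //; rewrite /L; lia.
move=> j jk; rewrite (spectral_orthogonal (sphere_kernel_spectral sd1 j) _ jk) ?mulr0//.
by apply: (proj_spectral sdn); case: l2.
Qed.

(** Against the component of psi of frequency q^k, f is a multiple of kern k, an
    eigenfunction of D^(n - 1) with nonzero eigenvalue and nonzero value at 0. *)
Lemma given_by_vanishing f : given_by S F f ->
  ((forall psi, lizn psi -> f 0 psi = 0) \/
   (forall psi, lizn psi -> fracDn S (V := L1) n.-1 (fun t => f t psi) 0 = 0)) ->
  forall t psi, lizn psi -> f t psi = 0.
Proof.
move=> fF f0 t psi l2; rewrite (given_by_unique t fF l2).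
suff F0 k : F (kern k) psi = 0.
  by rewrite /solution_density /symsum big1// => i _; rewrite F0 mulr0.
have fk : (fun t => f t (projn k psi)) = fun t => F (kern k) psi / kern k 0 * kern k t.
  apply/funext => u; rewrite (given_by_unique u fF (proj_lizorkin k l2)).
  rewrite solution_density_proj//; ring.
have lp := proj_lizorkin k l2.
case: f0 => [/(_ _ lp) f0|/(_ _ lp)].
  have := congr1 (fun g => g 0) fk; rewrite /= f0 => /esym/eqP.
  by rewrite divfK ?kern0_neq0// => /eqP.
have sk : spectral1 k (fun t => F (kern k) psi / kern k 0 * kern k t).
  rewrite (_ : (fun t => _) = lin (V := L1) (F (kern k) psi / kern k 0) (kern k) 0 (kern k)).
    by apply: (spectral_lin sd1); apply: (sphere_kernel_spectral sd1).
  by apply/funext => u; rewrite /lin mul0r addr0.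
rewrite fk; case: n.-1 => [|m].
  by rewrite /fracDn divfK ?kern0_neq0.
rewrite /fracDn (spectral_fracD sd1 _ sk) divfK ?kern0_neq0// => /eqP.
rewrite mulf_eq0 => /orP[|/eqP//].
rewrite fmorph_eq0 gt_eqF//; apply: powR_gt0; apply: exprz_gt0.
exact: lt_trans q_gt1.
Qed.

End Solution.

Theorem theorem2 (R : realType) (K : nonArchLocalFieldType)
    (S : local_field_data R K) (n : nat) (alpha : R)
    (F : (K -> R[i]) -> ('rV[K]_n -> R[i]) -> R[i]) :
  (1 <= n)%N -> 0 < alpha ->
  vdistribution S F ->
  generalized_solution S alpha F ->
  radial S F ->
  (exists f : K -> ('rV[K]_n -> R[i]) -> R[i], given_by S F f) /\
  (forall f : K -> ('rV[K]_n -> R[i]) -> R[i], given_by S F f ->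
     ((forall phi2, lizorkin S (V := affine S n) phi2 -> f 0 phi2 = 0) \/
      (forall phi2, lizorkin S (V := affine S n) phi2 ->
         fracDn S (V := line S) n.-1 (fun t => f t phi2) 0 = 0)) ->
     forall t phi2, lizorkin S (V := affine S n) phi2 -> f t phi2 = 0).
Proof.
move=> n1 a0 dF sF rF; split; last exact: given_by_vanishing n1 a0 dF sF rF.
by exists (solution_density S F); apply: solution_density_given_by n1 a0 dF sF rF.
Qed.
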